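(* Let $S$ be an immersed minimal surface in $S^{2n+1}$ with contact angle $\beta$ and Kähler angle $\alpha$, with respect to a local orthonormal tangent frame $(e_1,e_2)$ with $e_1\in TS\cap\Delta$. Then the Gaussian curvature $K$ of $S$ is $$K=-\sec^{2}\beta\,|\nabla\beta|^2-\tan\beta\,\Delta\beta-2\cos\alpha\,(1+2\tan^{2}\beta)\,\beta_1+2\tan\beta\,\sin\alpha\,\alpha_1-4\tan^{2}\beta\,\cos^{2}\alpha .$$
   Context: $S^{2n+1}=\{z\in\mathbb{C}^{n+1}: (z,z)=1\}$, where $(z,w)=\sum_{j=0}^n z^j\bar w^j$, with the metric induced by $\langle z,w\rangle=\mathrm{Re}(z,w)$. The Reeb field is $\xi(z)=iz$, and the contact distribution is $\Delta_z=\{v\in T_zS^{2n+1}:\langle\xi,v\rangle=0\}$, which is invariant under multiplication by $i$. For an immersed surface $S$ in $S^{2n+1}$, let $(e_1,e_2)$ be a local orthonormal frame of $TS$ with $e_1\in TS\cap\Delta$. The contact angle $\beta$ is the complementary angle between $\Delta$ and $TS$, given by $\cos\beta=\langle\xi,e_2\rangle$. Let $v$ be the unit vector field in $\Delta$, in the direction of the projection of $e_2$ to $\Delta$, with $e_2=\sin\beta\,v+\cos\beta\,\xi$. The Kähler angle $\alpha$ is defined by $\cos\alpha=\langle ie_1,v\rangle$. Notation: $\beta_1=d\beta(e_1)$ and $\alpha_1=d\alpha(e_1)$; $\nabla$ is the Levi-Civita connection (or gradient) of $S$ in the induced metric; $\Delta\beta=\mathrm{tr}\,\nabla d\beta$ is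 the Laplacian of $\beta$ on $S$ (not to be confused with the distribution $\Delta$). The formula is understood where the quantities in it are defined and smooth (in particular $\cos\beta\neq0$). *)

(* Defs.v *)
From HB Require Import structures.
From mathcomp Require Import all_boot all_order all_algebra.
From mathcomp Require Import all_classical all_reals all_analysis.
From mathcomp Require Import complex.

Set Implicit Arguments.
Unset Strict Implicit.
Unset Printing Implicit Defensive.

Import Order.TTheory GRing.Theory Num.Theory.
Import numFieldNormedType.Exports.

Local Open Scope classical_set_scope.
Local Open Scope ring_scope.
Local Open Scope complex_scope.

(* A surface is handled through a local parametrization F : U -> C^(n+1), where
   U is an open subset of the plane 'rV[R]_2; vectors of C^(n+1) are the rows
   'rV[R[i]]_n.+1. A tangent field of the surface is given by its coordinates
   X : 'rV[R]_2 -> 'rV[R]_2, the actual tangent vector being dF(X). *)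

Section Calculus.
Variable R : realType.

Definition bvec (i : 'I_2) : 'rV[R]_2 := delta_mx 0 i.

Definition partial (i : 'I_2) (f : 'rV[R]_2 -> R) : 'rV[R]_2 -> R :=
  fun p => 'd f p (bvec i).

(* Every iterated partial derivative, f itself included, is Frechet
   differentiable on U; on an open set U this is the same as C^infinity. *)
Definition smooth_on (U : set 'rV[R]_2) (f : 'rV[R]_2 -> R) : Prop :=
  forall (s : seq 'I_2) (p : 'rV[R]_2), U p -> differentiable (foldr partial f s) p.

Definition smooth_field (U : set 'rV[R]_2) (X : 'rV[R]_2 -> 'rV[R]_2) : Prop :=
  forall i : 'I_2, smooth_on U (fun p => X p 0 i).

Definition smooth_map (n : nat) (U : set 'rV[R]_2)
    (F : 'rV[R]_2 -> 'rV[R[i]]_n.+1) : Prop :=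
  forall k : 'I_n.+1, smooth_on U (fun p => complex.Re (F p 0 k))
                   /\ smooth_on U (fun p => complex.Im (F p 0 k)).

(* The real differential of F at p, applied to X. It is computed on the real
   and imaginary parts because R[i] carries no normed R-module structure. *)
Definition tangent_map (n : nat) (F : 'rV[R]_2 -> 'rV[R[i]]_n.+1)
    (p X : 'rV[R]_2) : 'rV[R[i]]_n.+1 :=
  \row_k ('d (fun q : 'rV[R]_2 => complex.Re (F q 0 k)) p X
          +i* 'd (fun q : 'rV[R]_2 => complex.Im (F q 0 k)) p X).

Definition vpartial (n : nat) (i : 'I_2) (F : 'rV[R]_2 -> 'rV[R[i]]_n.+1) :
    'rV[R]_2 -> 'rV[R[i]]_n.+1 :=
  fun p => tangent_map F p (bvec i).

End Calculus.

Section Riemannian.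
Variables (R : realType) (g : 'rV[R]_2 -> 'M[R]_2).

Definition gdot (p X Y : 'rV[R]_2) : R := (X *m g p *m Y^T) 0 0.

(* nabla_(d_i) d_j = \sum_k (christoffel k i j) d_k for the Levi-Civita
   connection of g. *)
Definition christoffel (k i j : 'I_2) (p : 'rV[R]_2) : R :=
  2^-1 * \sum_(l < 2) invmx (g p) k l *
    (partial i (fun q => g q j l) p + partial j (fun q => g q i l) p
     - partial l (fun q => g q i j) p).

(* R(d_i, d_j) d_k = \sum_l (riemann i j k l) d_l, with the convention
   R(X, Y) = [nabla_X, nabla_Y] - nabla_[X, Y]. *)
Definition riemann (i j k l : 'I_2) (p : 'rV[R]_2) : R :=
  partial i (christoffel l j k) p - partial j (christoffel l i k) p
  + \sum_(m < 2) (christoffel m j k p * christoffel l i m p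
                  - christoffel m i k p * christoffel l j m p).

(* <R(d_1, d_2) d_2, d_1> / (|d_1|^2 |d_2|^2 - <d_1, d_2>^2), the coordinates
   d_1, d_2 being indexed by ord0 and ord_max. *)
Definition gauss_curvature (p : 'rV[R]_2) : R :=
  (\sum_(l < 2) riemann ord0 ord_max ord_max l p * g p l ord0) / \det (g p).

Definition gradient (f : 'rV[R]_2 -> R) (p : 'rV[R]_2) : 'rV[R]_2 :=
  \row_i \sum_(j < 2) invmx (g p) i j * partial j f p.

Definition grad_norm2 (f : 'rV[R]_2 -> R) (p : 'rV[R]_2) : R :=
  gdot p (gradient f p) (gradient f p).

(* (nabla df)(d_i, d_j) *)
Definition hessian (f : 'rV[R]_2 -> R) (i j : 'I_2) (p : 'rV[R]_2) : R :=
  partial i (partial j f) p - \sum_(k < 2) christoffel k i j p * partial k f p.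

Definition laplacian (f : 'rV[R]_2 -> R) (p : 'rV[R]_2) : R :=
  \sum_(i < 2) \sum_(j < 2) invmx (g p) i j * hessian f i j p.

End Riemannian.

Section Sphere.
Variables (R : realType) (n : nat).

Definition herm (z w : 'rV[R[i]]_n.+1) : R[i] := \sum_(j < n.+1) z 0 j * ((w 0 j)^*)%C.

Definition rdot (z w : 'rV[R[i]]_n.+1) : R := complex.Re (herm z w).

Definition sphere : set 'rV[R[i]]_n.+1 := [set z | herm z z = 1].

Definition tangent_sphere (z : 'rV[R[i]]_n.+1) : set 'rV[R[i]]_n.+1 :=
  [set v | rdot z v = 0].

Definition reeb (z : 'rV[R[i]]_n.+1) : 'rV[R[i]]_n.+1 := 'i%C *: z.

Definition contact_dist (z : 'rV[R[i]]_n.+1) : set 'rV[R[i]]_n.+1 :=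
  [set v | tangent_sphere z v /\ rdot (reeb z) v = 0].

Variables (U : set 'rV[R]_2) (F : 'rV[R]_2 -> 'rV[R[i]]_n.+1).

Definition immersed_surface : Prop :=
  [/\ smooth_map U F,
      forall p, U p -> sphere (F p)
    & forall p, U p -> injective (tangent_map F p)].

Definition induced_metric (p : 'rV[R]_2) : 'M[R]_2 :=
  \matrix_(i, j) rdot (vpartial i F p) (vpartial j F p).

(* Component of w orthogonal to the surface and tangent to the sphere: one
   removes the projections of w to the line of F p and to the tangent plane. *)
Definition normal_part (p : 'rV[R]_2) (w : 'rV[R[i]]_n.+1) : 'rV[R[i]]_n.+1 :=
  w - (rdot w (F p))%:C *: F p
    - \sum_(k < 2) \sum_(l < 2)
        (invmx (induced_metric p) k l * rdot w (vpartial l F p))%:C *: vpartial k F p.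

(* Second fundamental form of the surface in the sphere, on (d_i, d_j). *)
Definition second_form (i j : 'I_2) (p : 'rV[R]_2) : 'rV[R[i]]_n.+1 :=
  normal_part p (vpartial i (vpartial j F) p).

Definition mean_curvature (p : 'rV[R]_2) : 'rV[R[i]]_n.+1 :=
  (2^-1)%:C *: \sum_(i < 2) \sum_(j < 2)
    (invmx (induced_metric p) i j)%:C *: second_form i j p.

Definition minimal_surface : Prop :=
  immersed_surface /\ forall p, U p -> mean_curvature p = 0.

(* (dF(X1), dF(X2)) is a smooth orthonormal tangent frame with
   dF(X1) in the contact distribution. *)
Definition adapted_frame (X1 X2 : 'rV[R]_2 -> 'rV[R]_2) : Prop :=
  [/\ smooth_field U X1, smooth_field U X2
    & forall p, U p ->
      let e1 := tangent_map F p (X1 p) in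
      let e2 := tangent_map F p (X2 p) in
      [/\ rdot e1 e1 = 1, rdot e2 e2 = 1, rdot e1 e2 = 0
        & contact_dist (F p) e1]].

Definition contact_angle (X2 : 'rV[R]_2 -> 'rV[R]_2) (beta : 'rV[R]_2 -> R) : Prop :=
  smooth_on U beta /\
  forall p, U p -> cos (beta p) = rdot (reeb (F p)) (tangent_map F p (X2 p)).

(* The projection of e2 to the contact distribution is sin(beta) v. No sign is
   imposed on sin(beta): the choice of beta in (0, pi), for which v is exactly
   the normalized projection, is one case. *)
Definition contact_direction (X2 : 'rV[R]_2 -> 'rV[R]_2) (beta : 'rV[R]_2 -> R)
    (v : 'rV[R]_2 -> 'rV[R[i]]_n.+1) : Prop :=
  smooth_map U v /\
  forall p, U p ->
    [/\ contact_dist (F p) (v p), rdot (v p) (v p) = 1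
      & tangent_map F p (X2 p)
        = (sin (beta p))%:C *: v p + (cos (beta p))%:C *: reeb (F p)].

Definition kahler_angle (X1 : 'rV[R]_2 -> 'rV[R]_2)
    (v : 'rV[R]_2 -> 'rV[R[i]]_n.+1) (alpha : 'rV[R]_2 -> R) : Prop :=
  smooth_on U alpha /\
  forall p, U p -> cos (alpha p) = rdot ('i%C *: tangent_map F p (X1 p)) (v p).

End Sphere.

(* Main.v *)
Require Import Defs.
From mathcomp Require Import all_boot all_order all_algebra.
From mathcomp Require Import all_classical all_reals all_analysis.
From mathcomp Require Import complex.
From mathcomp Require Import ring lra.

Set Implicit Arguments.
Unset Strict Implicit.

Import Order.TTheory GRing.Theory Num.Theory.
Import numFieldNormedType.Exports.

Local Open Scope classical_set_scope.
Local Open Scope ring_scope.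

(** Write xi for the Reeb field and T = cos(beta) e2 for the tangential part of xi
    along the surface. Everything is read off the 1-form h = <xi, .> on the
    surface, that is, the dual of T. Its coordinates are
    h_i = <iF, d_i F>, so that d_i h_j = <i d_i F, d_j F> + <iF, d_i d_j F>.

    - The first term is skew in (i, j) and the second symmetric, so
      dh(e1, e2) = 2 <i e1, e2> = 2 sin(beta) cos(alpha)
      ([curl_contact_form_frame], [rdot_i_frame]).
    - The symmetric part of the covariant derivative of h is the second fundamental
      form paired with xi. Its trace is zero on a minimal surface, so div h = 0
      ([divergence_contact_form]).

    Let omega be the connection form, nabla e1 = omega e2 and nabla e2 = - omega e1,
    and put w_a = omega(e_a), b_a = d beta(e_a). Since h(e1) = 0 and
    h(e2) = cos(beta), the two facts above, written in the frame, become

      cos(beta) w1 = - sin(beta) b2,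
      cos(beta) w2 = sin(beta) b1 + 2 sin(beta) cos(alpha)

    ([connection_form_X1], [connection_form_X2]); in short,
    omega = tan(beta) (star d beta + 2 cos(alpha) theta2) with theta2 dual to e2.
    Cartan's structure equation K = - d omega(e1, e2) ([gauss_curvature_frame]) together
    with the frame formula d omega(e1, e2) = e1(w2) - e2(w1) + w1^2 + w2^2, a case of
    [curl_frame], then gives the curvature: differentiating the two displayed identities
    produces the terms |nabla beta|^2, Delta beta and alpha_1.

    The Christoffel symbols of the induced metric are linked to the frame by the
    covariant derivative [nabla], which is metric ([partial_gdot]), torsion free
    ([christoffel_sym]) and has curvature [riemann] ([nabla_curvature]). The last
    statement, like the symmetry of d_i d_j F, rests on the symmetry of second
    partial derivatives, proved in the form of Young: the first derivatives need
    only be differentiable at the point ([young]). *)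

(** * Symmetry of second derivatives *)

(** The mean value theorem in the direction [u] turns the second difference into
    [t] times a difference of values of ['d f _ u] at two points at distance [O(t)]
    from [p]; differentiability of that function at [p] replaces this difference by
    [t * 'd (fun q => 'd f q u) p v] up to [o(t)]. *)
Lemma second_difference_estimate (R : realType) (V : normedModType R)
    (f : V -> R) (p u v : V) (e : R) :
    (\forall q \near p, differentiable f q) ->
    differentiable (fun q => 'd f q u) p -> 0 < e ->
  \forall t \near (0 : R)^'+,
    `|f (t *: u + (t *: v + p)) - f (t *: u + p) - f (t *: v + p) + f p
      - t ^+ 2 * 'd (fun q => 'd f q u) p v| <= e * t ^+ 2.
Proof.
move=> fnear + e_gt0; pose A : V -> R := fun q => 'd f q u.
rewrite -/A => dA.
pose M := `|u| + `|v| + 1.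
have M_gt0 : 0 < M by rewrite /M ltr_wpDl // addr_ge0.
(* The increments used below have norm at most [t * M], and there are two of them. *)
pose e' := e / (2 * M).
have e'_gt0 : 0 < e' by rewrite divr_gt0 // mulr_gt0.
have Anear : \forall x \near (0 : V), `|A (x + p) - A p - 'd A p x| <= e' * `|x|.
  have /eqaddoP/(_ _ e'_gt0) := diff_locally dA.
  apply: filterS => x /=.
  by rewrite /= !fctE /= opprD addrA.
have /nbhs_normP[d1 /= d1_gt0 Ad1] := Anear.
have /nbhs_normP[d2 /= d2_gt0 fd2] := fnear.
near=> t.
have t_gt0 : 0 < t by near: t; exact: nbhs_right_gt.
have tM1 : t * M < d1.
  rewrite -ltr_pdivlMr //; near: t; apply: nbhs_right_lt; exact: divr_gt0.
have tM2 : t * M < d2.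
  rewrite -ltr_pdivlMr //; near: t; apply: nbhs_right_lt; exact: divr_gt0.
have small c b : 0 <= c <= t -> 0 <= b <= t -> `|c *: u + b *: v| <= t * M.
  move=> /andP[c0 ct] /andP[b0 bt].
  rewrite (le_trans (ler_normD _ _)) // !normrZ !ger0_norm // /M !mulrDr mulr1.
  rewrite -[leLHS]addr0; apply: lerD; last exact: ltW.
  by apply: lerD; exact: ler_wpM2r.
have dfp x : `|x| <= t * M -> differentiable f (x + p).
  move=> xs; apply: fd2; rewrite /ball_ /= opprD addrCA subrr addr0 normrN.
  exact: le_lt_trans xs tM2.
have Ap x : `|x| <= t * M -> `|A (x + p) - A p - 'd A p x| <= e' * (t * M).
  move=> xs; apply: le_trans (Ad1 x _) _.
    by rewrite /ball_ /= sub0r normrN; exact: le_lt_trans xs tM1.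
  by rewrite ler_pM2l.
have der b c : 0 <= c <= t -> 0 <= b <= t ->
    is_derive c 1 (fun s : R => f (s *: u + (b *: v + p))) (A (c *: u + (b *: v + p))).
  move=> cint bint.
  have df : differentiable f (c *: u + (b *: v + p)).
    by rewrite addrA; apply: dfp; apply: small.
  have dl : is_diff c (fun s : R => s *: u + (b *: v + p)) (fun s : R => s *: u).
    have -> : (fun s : R => s *: u + (b *: v + p)) = (fun s => s *: u) + cst (b *: v + p).
      by [].
    apply: is_diff_eq; by rewrite addr0.
  have dfl := @differentiableP _ _ _ _ _ df.
  have dc := is_diff_comp dl dfl.
  have dcd : differentiable (f \o (fun s : R => s *: u + (b *: v + p))) c :=
    @ex_diff _ _ _ _ _ _ _ dc.
  apply: DeriveDef; first exact: diff_derivable.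
  by rewrite deriveE // (@diff_val _ _ _ _ _ _ _ dc) /= scale1r.
pose phi (s : R) := f (s *: u + (t *: v + p)) - f (s *: u + (0 *: v + p)).
pose dphi (s : R) := A (s *: u + (t *: v + p)) - A (s *: u + (0 *: v + p)).
have t_itv : 0 <= t <= t by rewrite lexx ltW.
have o_itv : 0 <= (0 : R) <= t by rewrite lexx ltW.
have dphiP c : 0 <= c <= t -> is_derive c 1 phi (dphi c).
  move=> c_itv; apply: is_deriveB; exact: der.
have [||c c_itv mvt] := @MVT R phi dphi 0 t t_gt0.
- by move=> c; rewrite in_itv /= => /andP[c0 ct]; apply: dphiP; rewrite !ltW.
- apply: derivable_within_continuous => c; rewrite in_itv /= => c_itv.
  by case: (dphiP c c_itv).
have {}c_itv : 0 <= c <= t.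
  by move: c_itv; rewrite in_itv /= => /andP[c0 ct]; rewrite !ltW.
have -> : f (t *: u + (t *: v + p)) - f (t *: u + p) - f (t *: v + p) + f p
    = dphi c * t.
  rewrite subr0 in mvt; rewrite -mvt /phi !scale0r !add0r; ring.
have := Ap _ (small _ _ c_itv t_itv); have := Ap _ (small _ _ c_itv o_itv).
have dA_add : 'd A p (c *: u + t *: v) = 'd A p (c *: u) + t * 'd A p v.
  by rewrite linearD [X in _ + X]linearZ.
rewrite /dphi !scale0r !add0r addr0 dA_add -(addrA (c *: u)).
set a1 := A (c *: u + p); set a2 := A (c *: u + (t *: v + p)) => h0 h1.
have -> : (a2 - a1) * t - t ^+ 2 * 'd A p v
   = t * ((a2 - A p - ('d A p (c *: u) + t * 'd A p v))
          - (a1 - A p - 'd A p (c *: u))) by ring.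
rewrite normrM gtr0_norm // expr2 mulrCA ler_pM2l //.
apply: le_trans (ler_normB _ _) _.
have -> : e * t = e' * (t * M) + e' * (t * M).
  by rewrite /e'; field; rewrite gt_eqF.
exact: lerD.
Unshelve. all: by end_near.
Qed.

(** The second difference is symmetric in [u] and [v], so the estimate in the
    direction [u] and the one in the direction [v] have the same limit. *)
Lemma young (R : realType) (V : normedModType R) (f : V -> R) (p u v : V) :
    (\forall q \near p, differentiable f q) ->
    differentiable (fun q => 'd f q u) p -> differentiable (fun q => 'd f q v) p ->
  'd (fun q => 'd f q u) p v = 'd (fun q => 'd f q v) p u.
Proof.
move=> fnear du dv; set a := 'd _ p v; set b := 'd _ p u.
apply/eqP; rewrite -subr_eq0 -normr_le0; apply/ler_addgt0Pl => e e_gt0.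
rewrite addr0.
have e2_gt0 : 0 < e / 2 by rewrite divr_gt0.
have hu := @second_difference_estimate _ _ _ _ _ v _ fnear du e2_gt0.
have hv := @second_difference_estimate _ _ _ _ _ u _ fnear dv e2_gt0.
have [t [t_gt0 [ht1 ht2]]] := filter_ex (filterI (nbhs_right_gt (0 : R)) (filterI hu hv)).
rewrite -/a -/b in ht1 ht2.
rewrite -(@ler_pM2l _ (t ^+ 2)); last by rewrite exprn_gt0.
rewrite -{1}(gtr0_norm (exprn_gt0 2 t_gt0)) -normrM.
(* Now both estimates speak of the same second difference of [f]. *)
rewrite addrCA in ht2.
move: ht1 ht2; set D0 := f (_ + _).
rewrite !ler_norml => /andP[h1 h2] /andP[h3 h4].
by apply/andP; split; nra.
Qed.

(** * Calculus of smooth functions on an open set of the plane *)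
Lemma is_diff_near_eq (R : realType) (V W : normedModType R) (f g : V -> W) (p : V)
    (df : {linear V -> W}) :
  (\forall q \near p, f q = g q) -> is_diff p f df -> is_diff p g df.
Proof.
move=> fg [diff_f diff_fE].
have fgp := nbhs_singleton fg.
have df_cont : continuous df by rewrite -diff_fE; exact: diff_continuous.
have g_exp : g \o shift p = cst (g p) + df +o_ 0 id.
  apply/eqaddoP => e e_gt0; have /eqaddoP/(_ e e_gt0) := diff_locally diff_f.
  have {}fg : \forall x \near (0 : V), f (x + p) = g (x + p).
    by move: fg; rewrite (near_shift 0) subr0.
  apply: filterS2 fg => x fgx /=.
  by rewrite !fctE /= -fgp -fgx -diff_fE.
have dg : 'd g p = df :> (V -> W) by exact: diff_unique.
by split=> //; apply/diff_locallyP; rewrite dg; split.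
Qed.

Section PointwiseDifferentials.
Variables (R : realType) (V : normedModType R).
Implicit Types (f g : V -> R) (p x : V).

Lemma diffD_at f g p x : differentiable f p -> differentiable g p ->
  'd (fun q => f q + g q : R) p x = 'd f p x + 'd g p x.
Proof. by move=> df dg; rewrite -[X in diff _ X]/(f + g) (diffD df dg). Qed.

Lemma diffM_at f g p x : differentiable f p -> differentiable g p ->
  'd (fun q => f q * g q : R) p x = f p * 'd g p x + g p * 'd f p x.
Proof. by move=> df dg; rewrite -[X in diff _ X]/(f * g) (diffM df dg). Qed.

Lemma diff_comp_at (phi dphi : R -> R) f p x :
  (forall y : R, is_derive y (1 : R) phi (dphi y)) -> differentiable f p ->
  differentiable (fun q => phi (f q) : R) p
  /\ 'd (fun q => phi (f q) : R) p x = dphi (f p) * 'd f p x.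
Proof.
move=> dphiP df; have [dphi_f dphi_fE] := dphiP (f p).
have diff_phi : differentiable phi (f p) by apply/derivable1_diffP.
split; first exact: (differentiable_comp df diff_phi).
rewrite -[X in diff _ X]/(phi \o f) (diff_comp df diff_phi) /= (diff1E diff_phi).
by rewrite derive1E dphi_fE -[LHS]/('d f p x * dphi (f p)) mulrC.
Qed.

End PointwiseDifferentials.

Section SmoothCalculus.
Variables (R : realType) (U : set 'rV[R]_2).
Hypothesis U_open : open U.
Implicit Types (f g h : 'rV[R]_2 -> R) (p : 'rV[R]_2) (i j : 'I_2).

Lemma partialD_at i f g p : differentiable f p -> differentiable g p ->
  partial i (fun q => f q + g q) p = partial i f p + partial i g p.
Proof. exact: diffD_at. Qed.

Lemma partialM_at i f g p : differentiable f p -> differentiable g p ->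
  partial i (fun q => f q * g q) p = f p * partial i g p + g p * partial i f p.
Proof. exact: diffM_at. Qed.

Lemma partial_cst i (c : R) p : partial i (fun=> c) p = 0.
Proof. by rewrite /partial diff_cst. Qed.

Lemma partial_comp i (phi dphi : R -> R) f p :
  (forall x : R, is_derive x (1 : R) phi (dphi x)) -> differentiable f p ->
  differentiable (fun q => phi (f q)) p
  /\ partial i (fun q => phi (f q)) p = dphi (f p) * partial i f p.
Proof. exact: diff_comp_at. Qed.

Lemma near_open f g p : {in U, f =1 g} -> U p -> \forall q \near p, f q = g q.
Proof.
move=> fg Up; have : \forall q \near p, U q by exact: open_nbhs_nbhs.
by apply: filterS => q Uq; apply: fg; rewrite inE.
Qed.

Lemma differentiable_eq_on f g p :
  {in U, f =1 g} -> U p -> differentiable f p -> differentiable g p.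
Proof.
move=> fg Up /differentiableP df.
exact: (@ex_diff _ _ _ _ _ _ _ (is_diff_near_eq (near_open fg Up) df)).
Qed.

Lemma partial_eq_on i f g p :
  {in U, f =1 g} -> U p -> differentiable f p -> partial i f p = partial i g p.
Proof.
move=> fg Up /differentiableP df; rewrite /partial.
by rewrite (@diff_val _ _ _ _ _ _ _ (is_diff_near_eq (near_open fg Up) df)).
Qed.

(** Differentiability up to order [k], defined by recursion on [k] so that closure
    under products, which mixes the derivatives of the factors, is an induction. *)
Fixpoint times_differentiable (k : nat) f : Prop :=
  (forall p, U p -> differentiable f p) /\
  (if k is k'.+1 then forall i, times_differentiable k' (partial i f) else True).

(** [smooth_on] peels off the last derivative applied, [times_differentiable] the
    first one. *)
Lemma smooth_onP f : smooth_on U f <-> forall k, times_differentiable k f.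
Proof.
split=> [sf k|tf s].
  elim: k f sf => [|k IH] f sf; split=> //; try by move=> p; exact: (sf [::]).
  by move=> i; apply: IH => s p Up; rewrite -foldr_rcons; exact: sf.
elim/last_ind: s f tf => [|s i IH] f tf p Up; first by case: (tf 0%N) => + _; apply.
by rewrite foldr_rcons; apply: IH => // k; have [_ pf] := tf k.+1; exact: pf.
Qed.

Lemma times_differentiable_eq k f g :
  {in U, f =1 g} -> times_differentiable k f -> times_differentiable k g.
Proof.
elim: k f g => [|k IH] f g fg [df pf]; 
  (split=> [p Up|]; first exact: differentiable_eq_on fg Up (df p Up)).
  exact: I.
move=> i; apply: IH (pf i) => p; rewrite inE => Up.
exact: partial_eq_on fg Up (df p Up).
Qed.

Lemma times_differentiableW k f : times_differentiable k.+1 f -> times_differentiable k f.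
Proof.
elim: k f => [|k IH] f [df pf]; first by split.
by split=> // i; apply: IH; exact: pf.
Qed.

Lemma times_differentiable_cst k (c : R) : times_differentiable k (fun=> c).
Proof.
elim: k c => [|k IH] c; 
  (split=> [p _|]; first exact: differentiable_cst).
  exact: I.
by move=> i; apply: times_differentiable_eq (IH 0) => p _; rewrite partial_cst.
Qed.

Lemma times_differentiableD k f g : times_differentiable k f ->
  times_differentiable k g -> times_differentiable k (fun q => f q + g q).
Proof.
elim: k f g => [|k IH] f g [df pf] [dg pg];
  (split=> [p Up|]; first exact: differentiableD (df p Up) (dg p Up)).
  exact: I.
move=> i; apply: times_differentiable_eq (IH _ _ (pf i) (pg i)) => p.
by rewrite inE => Up; rewrite (partialD_at i (df p Up) (dg p Up)).
Qed.

Lemma times_differentiableM k f g : times_differentiable k f ->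
  times_differentiable k g -> times_differentiable k (fun q => f q * g q).
Proof.
elim: k f g => [|k IH] f g tf tg; have [df pf] := tf; have [dg pg] := tg;
  (split=> [p Up|]; first exact: differentiableM (df p Up) (dg p Up)).
  exact: I.
move=> i; have := times_differentiableD (IH _ _ (times_differentiableW tf) (pg i))
                    (IH _ _ (times_differentiableW tg) (pf i)).
apply: times_differentiable_eq => p; rewrite inE => Up.
by rewrite (partialM_at i (df p Up) (dg p Up)).
Qed.

(** Each of cos and sin is needed at order [k] to get the other at order [k.+1]. *)
Lemma times_differentiable_trig k f : times_differentiable k f ->
  times_differentiable k (fun q => cos (f q)) /\
  times_differentiable k (fun q => sin (f q)).
Proof.
elim: k f => [|k IH] f tf; have [df pf] := tf.
  by split; split=> // p Up;
    [case: (partial_comp ord0 (@is_derive_cos R) (df p Up))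
    |case: (partial_comp ord0 (@is_derive_sin R) (df p Up))].
have [tcos tsin] := IH f (times_differentiableW tf).
split; (split=> [p Up|i]).
- by case: (partial_comp ord0 (@is_derive_cos R) (df p Up)).
- have := times_differentiableM (times_differentiable_cst k (-1))
            (times_differentiableM tsin (pf i)).
  apply: times_differentiable_eq => p; rewrite inE => Up.
  have [_ ->] := partial_comp i (@is_derive_cos R) (df p Up).
  by rewrite mulN1r mulNr.
- by case: (partial_comp ord0 (@is_derive_sin R) (df p Up)).
- have := times_differentiableM tcos (pf i).
  apply: times_differentiable_eq => p; rewrite inE => Up.
  by have [_ ->] := partial_comp i (@is_derive_sin R) (df p Up).
Qed.

Lemma smooth_differentiable f p : smooth_on U f -> U p -> differentiable f p.
Proof. by move=> sf Up; exact: (sf [::]). Qed.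

Lemma smooth_partial i f : smooth_on U f -> smooth_on U (partial i f).
Proof. by move=> sf s p Up; rewrite -foldr_rcons; exact: sf. Qed.

Lemma smooth_eq_on f g : {in U, f =1 g} -> smooth_on U f -> smooth_on U g.
Proof.
move=> fg /smooth_onP sf; apply/smooth_onP => k.
exact: times_differentiable_eq fg (sf k).
Qed.

Lemma smooth_cst (c : R) : smooth_on U (fun=> c).
Proof. apply/smooth_onP => k; exact: times_differentiable_cst. Qed.

Lemma smoothD f g : smooth_on U f -> smooth_on U g -> smooth_on U (fun q => f q + g q).
Proof.
move=> /smooth_onP sf /smooth_onP sg; apply/smooth_onP => k.
exact: times_differentiableD.
Qed.

Lemma smoothM f g : smooth_on U f -> smooth_on U g -> smooth_on U (fun q => f q * g q).
Proof.
move=> /smooth_onP sf /smooth_onP sg; apply/smooth_onP => k.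
exact: times_differentiableM.
Qed.

Lemma smoothN f : smooth_on U f -> smooth_on U (fun q => - f q).
Proof.
move=> sf; apply: smooth_eq_on (smoothM (smooth_cst (-1)) sf) => q _.
by rewrite mulN1r.
Qed.

Lemma smoothB f g : smooth_on U f -> smooth_on U g -> smooth_on U (fun q => f q - g q).
Proof. by move=> sf sg; exact: smoothD sf (smoothN sg). Qed.

Lemma smooth_sum (I : Type) (r : seq I) (f : I -> 'rV[R]_2 -> R) :
  (forall k, smooth_on U (f k)) -> smooth_on U (fun q => \sum_(k <- r) f k q).
Proof.
move=> sf; elim: r => [|k r IH].
  by apply: smooth_eq_on (smooth_cst 0) => q _; rewrite big_nil.
by apply: smooth_eq_on (smoothD (sf k) IH) => q _; rewrite big_cons.
Qed.

Lemma smooth_cos f : smooth_on U f -> smooth_on U (fun q => cos (f q)).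
Proof.
by move=> /smooth_onP sf; apply/smooth_onP => k; case: (times_differentiable_trig (sf k)).
Qed.

Lemma smooth_sin f : smooth_on U f -> smooth_on U (fun q => sin (f q)).
Proof.
by move=> /smooth_onP sf; apply/smooth_onP => k; case: (times_differentiable_trig (sf k)).
Qed.

Section PartialAt.
Variable p : 'rV[R]_2.
Hypothesis Up : U p.

Lemma partial_eq i f g : smooth_on U f -> {in U, f =1 g} -> partial i f p = partial i g p.
Proof. by move=> sf fg; exact: partial_eq_on fg Up (smooth_differentiable sf Up). Qed.

Lemma partialD i f g : smooth_on U f -> smooth_on U g ->
  partial i (fun q => f q + g q) p = partial i f p + partial i g p.
Proof. by move=> sf sg; apply: partialD_at; apply: smooth_differentiable. Qed.

Lemma partialM i f g : smooth_on U f -> smooth_on U g ->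
  partial i (fun q => f q * g q) p = f p * partial i g p + g p * partial i f p.
Proof. by move=> sf sg; apply: partialM_at; apply: smooth_differentiable. Qed.

Lemma partialN i f : smooth_on U f -> partial i (fun q => - f q) p = - partial i f p.
Proof.
move=> sf; have -> : (fun q => - f q) = (fun q => (fun=> -1) q * f q).
  by apply/funext => q; rewrite mulN1r.
by rewrite (partialM _ (smooth_cst _) sf) partial_cst mulr0 addr0 mulN1r.
Qed.

Lemma partial_sum (I : Type) (r : seq I) (f : I -> 'rV[R]_2 -> R) i :
    (forall k, smooth_on U (f k)) ->
  partial i (fun q => \sum_(k <- r) f k q) p = \sum_(k <- r) partial i (f k) p.
Proof.
move=> sf; elim: r => [|k r IH].
  rewrite big_nil; under eq_fun do rewrite big_nil.
  exact: partial_cst.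
rewrite big_cons -IH; under eq_fun do rewrite big_cons.
by rewrite partialD //; exact: smooth_sum.
Qed.

Lemma partial_partialC i j f : smooth_on U f ->
  partial i (partial j f) p = partial j (partial i f) p.
Proof.
move=> sf; apply: young; last 2 first.
- exact: smooth_differentiable (smooth_partial j sf) Up.
- exact: smooth_differentiable (smooth_partial i sf) Up.
have : \forall q \near p, U q by exact: open_nbhs_nbhs.
by apply: filterS => q Uq; exact: smooth_differentiable sf Uq.
Qed.

Lemma partial_cos i f : smooth_on U f ->
  partial i (fun q => cos (f q)) p = - sin (f p) * partial i f p.
Proof.
move=> sf.
by have [_ ->] := partial_comp i (@is_derive_cos R) (smooth_differentiable sf Up).
Qed.

Lemma partial_sin i f : smooth_on U f ->
  partial i (fun q => sin (f q)) p = cos (f p) * partial i f p.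
Proof.
move=> sf.
by have [_ ->] := partial_comp i (@is_derive_sin R) (smooth_differentiable sf Up).
Qed.

End PartialAt.
End SmoothCalculus.

(** * The Levi-Civita connection in coordinates *)

(** [ring] compares its atoms up to conversion, and unfolding two distinct derivatives
    to see that they differ is prohibitively long; the atoms are first replaced by
    variables, which only uses syntactic equality. For the same reason, many steps
    below combine two equations with [f_equal2] instead of rewriting. *)
Ltac generalize_atoms :=
  repeat match goal with
  | |- context [rdot ?z ?w] => generalize (rdot z w); intro
  | |- context [riemann ?g ?i ?j ?k ?l ?p] => generalize (riemann g i j k l p); intro
  | |- context [partial ?i ?f ?p] => generalize (partial i f p); intro
  | |- context [christoffel ?g ?k ?i ?j ?p] => generalize (christoffel g k i j p); intro
  | |- context [@fun_of_matrix ?T ?a ?b ?A ?i ?j] =>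
      generalize (@fun_of_matrix T a b A i j); intro
  end.

Ltac ring_atoms := generalize_atoms; ring.

Section LeviCivita.
Variables (R : realType) (U : set 'rV[R]_2) (g : 'rV[R]_2 -> 'M[R]_2).
Hypothesis U_open : open U.
Hypothesis g_sym : forall q i j, g q i j = g q j i.
Hypothesis g_unit : forall q, U q -> g q \in unitmx.
Hypothesis g_smooth : forall i j, smooth_on U (fun q => g q i j).
Hypothesis invg_smooth : forall i j, smooth_on U (fun q => invmx (g q) i j).
Implicit Types (p q : 'rV[R]_2) (X Y : 'rV[R]_2 -> 'rV[R]_2) (f : 'rV[R]_2 -> R).
Implicit Types (i j k l m : 'I_2) (h : 'I_2 -> 'rV[R]_2 -> R).

Lemma sum_ord2 (V : nmodType) (F : 'I_2 -> V) : \sum_(i < 2) F i = F ord0 + F ord_max.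
Proof.
by rewrite !big_ord_recl big_ord0 addr0; congr (_ + F _); apply: val_inj.
Qed.

Lemma ord2P i : {i = ord0} + {i = ord_max}.
Proof. by case: i => -[|[|i]] // Hi; [left|right]; apply: val_inj. Qed.

Lemma gdotE p (x y : 'rV[R]_2) :
  gdot g p x y = x 0 ord0 * g p ord0 ord0 * y 0 ord0
    + x 0 ord0 * g p ord0 ord_max * y 0 ord_max
    + (x 0 ord_max * g p ord_max ord0 * y 0 ord0
       + x 0 ord_max * g p ord_max ord_max * y 0 ord_max).
Proof. rewrite /gdot mxE sum_ord2 !mxE !sum_ord2; ring. Qed.

Lemma christoffel_smooth k i j : smooth_on U (christoffel g k i j).
Proof.
apply: smoothM => //; first exact: smooth_cst.
apply: smooth_sum => // l; apply: smoothM => //.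
by apply: smoothB => //; [apply: smoothD => //|]; exact: smooth_partial.
Qed.

Lemma christoffel_sym k i j p : christoffel g k i j p = christoffel g k j i p.
Proof.
rewrite /christoffel.
have -> : (fun q => g q i j) = (fun q => g q j i) by apply/funext => q.
congr (_ * _).
apply: eq_bigr => l _.
by rewrite (addrC (partial i _ p)).
Qed.

(** The Christoffel symbols of the first kind. *)
Lemma lower_christoffel i j m p : U p ->
  g p m ord0 * christoffel g ord0 i j p + g p m ord_max * christoffel g ord_max i j p =
  2^-1 * (partial i (fun q => g q j m) p + partial j (fun q => g q i m) p
          - partial m (fun q => g q i j) p).
Proof.
move=> Up; rewrite -(sum_ord2 (fun k => g p m k * christoffel g k i j p)).
set c := fun l => partial i (fun q => g q j l) p
  + partial j (fun q => g q i l) p - partial l (fun q => g q i j) p.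
transitivity (\sum_(l < 2) (g p *m invmx (g p)) m l * (2^-1 * c l)).
  under eq_bigr do rewrite /christoffel -/(c _) mulr_sumr mulr_sumr.
  rewrite exchange_big; apply: eq_bigr => l _; rewrite mxE mulr_suml.
  by apply: eq_bigr => k _; rewrite /c; ring.
rewrite mulmxV ?g_unit // (bigD1 m) //= big1 => [|l /negPf lm].
  by rewrite mxE eqxx mul1r addr0.
by rewrite mxE eq_sym lm mul0r.
Qed.

(** The connection is metric: the three first-kind symbols that occur in the
    definition are recombined. *)
Lemma partial_metric i j k p : U p ->
  partial i (fun q => g q j k) p =
  g p k ord0 * christoffel g ord0 i j p + g p k ord_max * christoffel g ord_max i j p
  + (g p j ord0 * christoffel g ord0 i k p + g p j ord_max * christoffel g ord_max i k p).
Proof.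
move=> Up.
refine (etrans _ (esym (f_equal2 +%R (lower_christoffel i j k Up)
                                     (lower_christoffel i k j Up)))).
have -> : (fun q => g q k j) = (fun q => g q j k) by apply/funext => q.
set a := partial _ _ _; set b := partial _ _ _; set c := partial _ _ _.
by field.
Qed.

(** The covariant derivative of a tangent field along a coordinate direction. *)
Definition nabla i X p : 'rV[R]_2 :=
  \row_k (partial i (fun q => X q 0 k) p
          + \sum_(m < 2) christoffel g k i m p * X p 0 m).

Lemma nablaE i X p k : nabla i X p 0 k = partial i (fun q => X q 0 k) p
  + (christoffel g k i ord0 p * X p 0 ord0
     + christoffel g k i ord_max p * X p 0 ord_max).
Proof. by rewrite mxE sum_ord2. Qed.

Lemma rowZE (a : R) (x : 'rV[R]_2) k : (a *: x) 0 k = a * x 0 k.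
Proof. by rewrite mxE. Qed.

Lemma rowDE (x y : 'rV[R]_2) k : (x + y) 0 k = x 0 k + y 0 k.
Proof. by rewrite mxE. Qed.

Lemma rowBE (x y : 'rV[R]_2) k : (x - y) 0 k = x 0 k - y 0 k.
Proof. by rewrite !mxE. Qed.

Lemma nabla_smooth i X : smooth_field U X -> smooth_field U (nabla i X).
Proof.
move=> sX k; apply: smooth_eq_on (_ : smooth_on U (fun q => partial i (fun q => X q 0 k) q
  + \sum_(m < 2) christoffel g k i m q * X q 0 m)) => //.
  by move=> q _; rewrite mxE.
apply: smoothD => //; first exact: smooth_partial.
by apply: smooth_sum => // m; apply: smoothM => //; exact: christoffel_smooth.
Qed.

Lemma nabla_eq_on i X Y p : smooth_field U X -> {in U, X =1 Y} -> U p ->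
  nabla i X p = nabla i Y p.
Proof.
move=> sX XY Up; apply/rowP => k; rewrite !nablaE.
have -> : X p = Y p by apply: XY; rewrite inE.
rewrite (partial_eq U_open Up i (sX k) (_ : {in U, _ =1 (fun q => Y q 0 k)})) //.
by move=> q Uq; rewrite XY.
Qed.

Lemma nablaZ i f X p : smooth_on U f -> smooth_field U X -> U p ->
  nabla i (fun q => f q *: X q) p = partial i f p *: X p + f p *: nabla i X p.
Proof.
move=> sf sX Up; apply/rowP => k; rewrite rowDE !rowZE !nablaE.
under eq_fun do rewrite rowZE.
rewrite (partialM Up i sf (sX k)).
rewrite !rowZE.
ring_atoms.
Qed.

Lemma partial_gdot i X Y p : smooth_field U X -> smooth_field U Y -> U p ->
  partial i (fun q => gdot g q (X q) (Y q)) p =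
  gdot g p (nabla i X p) (Y p) + gdot g p (X p) (nabla i Y p).
Proof.
move=> sX sY Up; under eq_fun do rewrite gdotE.
have s1 k l : smooth_on U (fun q => X q 0 k * g q k l).
  exact: (smoothM U_open (sX k) (g_smooth k l)).
have s2 k l : smooth_on U (fun q => X q 0 k * g q k l * Y q 0 l).
  exact: (smoothM U_open (s1 k l) (sY l)).
have E k l : partial i (fun q => X q 0 k * g q k l * Y q 0 l) p =
  X p 0 k * g p k l * partial i (fun q => Y q 0 l) p
  + Y p 0 l * (X p 0 k * partial i (fun q => g q k l) p
               + g p k l * partial i (fun q => X q 0 k) p).
  by rewrite (partialM Up i (s1 k l) (sY l)) (partialM Up i (sX k) (g_smooth k l)).
have s3 k := smoothD U_open (s2 k ord0) (s2 k ord_max).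
rewrite (partialD Up i (s3 ord0) (s3 ord_max)).
rewrite (partialD Up i (s2 ord0 ord0) (s2 ord0 ord_max)).
rewrite (partialD Up i (s2 ord_max ord0) (s2 ord_max ord_max)).
rewrite !E !(partial_metric _ _ _ Up) !gdotE !nablaE (g_sym p ord_max ord0).
ring_atoms.
Qed.

Lemma riemannE i j k l p : riemann g i j k l p =
  partial i (christoffel g l j k) p - partial j (christoffel g l i k) p
  + (christoffel g ord0 j k p * christoffel g l i ord0 p
     - christoffel g ord0 i k p * christoffel g l j ord0 p
     + (christoffel g ord_max j k p * christoffel g l i ord_max p
        - christoffel g ord_max i k p * christoffel g l j ord_max p)).
Proof. by rewrite /riemann sum_ord2. Qed.

(** Coordinate fields commute, so the curvature is the plain commutator of the two
    covariant derivatives; the second partial derivatives of [X] cancel by symmetry. *)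
Lemma nabla_curvature i j X p l : smooth_field U X -> U p ->
  (nabla i (nabla j X) p - nabla j (nabla i X) p) 0 l =
  X p 0 ord0 * riemann g i j ord0 l p + X p 0 ord_max * riemann g i j ord_max l p.
Proof.
move=> sX Up.
have sC := christoffel_smooth.
have E a b : nabla a (nabla b X) p 0 l =
  partial a (partial b (fun q => X q 0 l)) p
  + (christoffel g l b ord0 p * partial a (fun q => X q 0 ord0) p
     + X p 0 ord0 * partial a (christoffel g l b ord0) p
     + (christoffel g l b ord_max p * partial a (fun q => X q 0 ord_max) p
        + X p 0 ord_max * partial a (christoffel g l b ord_max) p))
  + (christoffel g l a ord0 p * nabla b X p 0 ord0
     + christoffel g l a ord_max p * nabla b X p 0 ord_max).
  rewrite nablaE; congr (_ + _).
  under eq_fun do rewrite nablaE.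
  have sT m := smoothM U_open (sC l b m) (sX m).
  rewrite (partialD Up a (smooth_partial b (sX l)) (smoothD U_open (sT ord0) (sT ord_max))).
  rewrite (partialD Up a (sT ord0) (sT ord_max)).
  rewrite (partialM Up a (sC l b ord0) (sX ord0)).
  by rewrite (partialM Up a (sC l b ord_max) (sX ord_max)).
rewrite rowBE.
move: (E i j) (E j i) (partial_partialC U_open Up i j (sX l)).
move: (riemannE i j ord0 l p) (riemannE i j ord_max l p).
move: (nablaE i X p ord0) (nablaE i X p ord_max) (nablaE j X p ord0) (nablaE j X p ord_max).
generalize_atoms => -> -> -> -> -> -> -> -> ->.
ring.
Qed.

Definition pairing h (x : 'rV[R]_2) q : R := h ord0 q * x 0 ord0 + h ord_max q * x 0 ord_max.

(** The component [(nabla_(d_i) h)(d_j)] of the covariant derivative of a 1-form. *)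
Definition nabla_form i h j p : R :=
  partial i (h j) p
  - (christoffel g ord0 i j p * h ord0 p + christoffel g ord_max i j p * h ord_max p).

Lemma pairing_smooth h X : (forall i, smooth_on U (h i)) -> smooth_field U X ->
  smooth_on U (fun q => pairing h (X q) q).
Proof.
move=> sh sX; have sP i := smoothM U_open (sh i) (sX i).
exact: (smoothD U_open (sP ord0) (sP ord_max)).
Qed.

Lemma partial_pairing i h X p : (forall j, smooth_on U (h j)) -> smooth_field U X ->
  U p ->
  partial i (fun q => pairing h (X q) q) p =
  pairing (nabla_form i h) (X p) p + pairing h (nabla i X p) p.
Proof.
move=> sh sX Up; have sP j := smoothM U_open (sh j) (sX j).
rewrite /pairing (partialD Up i (sP ord0) (sP ord_max)) /nabla_form !nablaE.
rewrite (partialM Up i (sh ord0) (sX ord0)) (partialM Up i (sh ord_max) (sX ord_max)).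
ring_atoms.
Qed.

End LeviCivita.

(** * Orthonormal frames and Cartan's structure equations *)
Lemma det_mx22 (R : comNzRingType) (A : 'M[R]_2) :
  \det A = A ord0 ord0 * A ord_max ord_max - A ord0 ord_max * A ord_max ord0.
Proof.
rewrite (expand_det_row _ ord0) sum_ord2 /cofactor !det_mx11 !mxE /=.
rewrite expr0 expr1 mul1r mulN1r mulrN.
by congr (_ * A _ _ - _ * A _ _); apply: val_inj.
Qed.

Section OrthonormalFrame.
Variables (R : realType) (U : set 'rV[R]_2) (g : 'rV[R]_2 -> 'M[R]_2).
Variables (X1 X2 : 'rV[R]_2 -> 'rV[R]_2).
Hypothesis U_open : open U.
Hypothesis g_sym : forall q i j, g q i j = g q j i.
Hypothesis g_smooth : forall i j, smooth_on U (fun q => g q i j).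
Hypothesis X1_smooth : smooth_field U X1.
Hypothesis X2_smooth : smooth_field U X2.
Hypothesis X11 : forall q, U q -> gdot g q (X1 q) (X1 q) = 1.
Hypothesis X22 : forall q, U q -> gdot g q (X2 q) (X2 q) = 1.
Hypothesis X12 : forall q, U q -> gdot g q (X1 q) (X2 q) = 0.
Implicit Types (p q : 'rV[R]_2) (f : 'rV[R]_2 -> R).
Implicit Types (i j k l m : 'I_2) (h : 'I_2 -> 'rV[R]_2 -> R).

Definition frame_inverse q : 'M[R]_2 :=
  \matrix_(k, l) (X1 q 0 k * X1 q 0 l + X2 q 0 k * X2 q 0 l).

Lemma gdotC q x y : gdot g q x y = gdot g q y x.
Proof. rewrite !gdotE (g_sym q ord_max ord0); ring_atoms. Qed.

(** If the rows of X are the two fields, orthonormality says X g X^T = 1; the factors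
    may be permuted cyclically. *)
Lemma mul_frame_inverse q : U q -> g q *m frame_inverse q = 1%:M.
Proof.
move=> Uq; pose X := \matrix_(a < 2, i < 2) (if a == ord0 then X1 q 0 i else X2 q 0 i).
have rowX a : row a X = if a == ord0 then X1 q else X2 q.
  by apply/rowP => i; rewrite !mxE; case: ifP.
have gram : X *m (g q *m X^T) = 1%:M.
  apply/matrixP => a b.
  have -> : (X *m (g q *m X^T)) a b = gdot g q (row a X) (row b X).
    rewrite /gdot -mulmxA !mxE; apply: eq_bigr => k _; rewrite !mxE.
    by congr (_ * _); apply: eq_bigr => l _; rewrite !mxE.
  rewrite !rowX mxE.
  have [->|->] := ord2P a; have [->|->] := ord2P b => /=.
  - exact: X11.
  - exact: X12.
  - by rewrite gdotC; exact: X12.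
  - exact: X22.
have := mulmx1C gram; rewrite -mulmxA => {1}<-; congr (_ *m _).
apply/matrixP => k l; rewrite !mxE sum_ord2 !mxE.
by [].
Qed.

Lemma frame_unit q : U q -> g q \in unitmx.
Proof. by move=> Uq; have [] := mulmx1_unit (mul_frame_inverse Uq). Qed.

Lemma invmx_frame q : U q -> invmx (g q) = frame_inverse q.
Proof.
move=> Uq; rewrite -[LHS]mulmx1 -(mul_frame_inverse Uq) mulKmx //.
exact: frame_unit.
Qed.

Lemma frame_inverseE q k l : frame_inverse q k l = X1 q 0 k * X1 q 0 l + X2 q 0 k * X2 q 0 l.
Proof. by rewrite mxE. Qed.

Lemma invg_smooth_frame k l : smooth_on U (fun q => invmx (g q) k l).
Proof.
apply: (smooth_eq_on U_open (_ : {in U, (fun q => X1 q 0 k * X1 q 0 l + X2 q 0 k * X2 q 0 l)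
   =1 _})).
  by move=> q; rewrite inE => Uq; rewrite invmx_frame // frame_inverseE.
exact: (smoothD U_open (smoothM U_open (X1_smooth k) (X1_smooth l))
                       (smoothM U_open (X2_smooth k) (X2_smooth l))).
Qed.

Lemma mul_frame_inverseE q i j : U q ->
  g q i ord0 * frame_inverse q ord0 j + g q i ord_max * frame_inverse q ord_max j
  = (i == j)%:R.
Proof.
move=> Uq; have /matrixP/(_ i j) := mul_frame_inverse Uq.
by rewrite mxE sum_ord2 => ->; rewrite mxE.
Qed.

Lemma frame_expansion q x : U q ->
  x = gdot g q x (X1 q) *: X1 q + gdot g q x (X2 q) *: X2 q.
Proof.
move=> Uq; apply/rowP => k; rewrite rowDE !rowZE !gdotE.
have E0 := mul_frame_inverseE ord0 k Uq; have E1 := mul_frame_inverseE ord_max k Uq.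
transitivity (x 0 ord0 * (ord0 == k)%:R + x 0 ord_max * (ord_max == k)%:R).
  by have [->|->] := ord2P k; rewrite /= ?mulr1 ?mulr0 ?addr0 ?add0r.
rewrite -E0 -E1 !frame_inverseE; ring_atoms.
Qed.

(** The form omega with nabla X1 = omega X2 and nabla X2 = - omega X1. *)
Definition connection_form i q : R := gdot g q (nabla g i X1 q) (X2 q).

Let nabla_g_smooth := @nabla_smooth R U g U_open g_smooth invg_smooth_frame.

Lemma gdot_smooth (X Y : 'rV[R]_2 -> 'rV[R]_2) : smooth_field U X -> smooth_field U Y ->
  smooth_on U (fun q => gdot g q (X q) (Y q)).
Proof.
move=> sX sY; under eq_fun do rewrite gdotE.
have s k l := smoothM U_open (smoothM U_open (sX k) (g_smooth k l)) (sY l).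
exact: (smoothD U_open (smoothD U_open (s ord0 ord0) (s ord0 ord_max))
                       (smoothD U_open (s ord_max ord0) (s ord_max ord_max))).
Qed.

Lemma connection_form_smooth i : smooth_on U (connection_form i).
Proof. by apply: gdot_smooth => //; exact: nabla_g_smooth. Qed.

(** Differentiating the orthonormality relations. *)
Lemma partial_gdot_const i (X Y : 'rV[R]_2 -> 'rV[R]_2) (c : R) p :
    smooth_field U X -> smooth_field U Y ->
    (forall q, U q -> gdot g q (X q) (Y q) = c) -> U p ->
  gdot g p (nabla g i X p) (Y p) + gdot g p (X p) (nabla g i Y p) = 0.
Proof.
move=> sX sY XYc Up.
rewrite -(partial_gdot U_open g_sym frame_unit g_smooth i sX sY Up).
rewrite (partial_eq U_open Up i (gdot_smooth sX sY) (_ : {in U, _ =1 (fun=> c)})).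
  exact: partial_cst.
by move=> q; rewrite inE => /XYc.
Qed.

Lemma nabla_frame1 i q : U q -> nabla g i X1 q = connection_form i q *: X2 q.
Proof.
move=> Uq; rewrite {1}(frame_expansion (nabla g i X1 q) Uq).
have := partial_gdot_const i X1_smooth X1_smooth X11 Uq.
rewrite (gdotC q (X1 q)) -mulr2n => /eqP; rewrite mulrn_eq0 /= => /eqP ->.
by rewrite scale0r add0r.
Qed.

Lemma nabla_frame2 i q : U q -> nabla g i X2 q = - connection_form i q *: X1 q.
Proof.
move=> Uq; rewrite {1}(frame_expansion (nabla g i X2 q) Uq).
have := partial_gdot_const i X2_smooth X2_smooth X22 Uq.
rewrite (gdotC q (X2 q)) -mulr2n => /eqP; rewrite mulrn_eq0 /= => /eqP ->.
rewrite scale0r addr0; congr (_ *: _); apply/eqP; rewrite -addr_eq0 addrC (gdotC q _ (X1 q)).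
by rewrite (partial_gdot_const i X1_smooth X2_smooth X12 Uq).
Qed.

(** The exterior derivative of [h], evaluated on the two coordinate fields. *)
Definition curl h p : R := partial ord0 (h ord_max) p - partial ord_max (h ord0) p.

(** Differentiating [nabla X1 = omega X2] once more, the terms in [omega * omega] are
    symmetric and drop out of the commutator. *)
Lemma riemann_frame1 l p : U p ->
  X1 p 0 ord0 * riemann g ord0 ord_max ord0 l p
  + X1 p 0 ord_max * riemann g ord0 ord_max ord_max l p = curl connection_form p * X2 p 0 l.
Proof.
move=> Up.
rewrite -(nabla_curvature U_open g_smooth invg_smooth_frame ord0 ord_max l X1_smooth Up).
have E i j : nabla g i (nabla g j X1) p 0 l =
  partial i (connection_form j) p * X2 p 0 l
  + connection_form j p * (- connection_form i p * X1 p 0 l).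
  rewrite (nabla_eq_on g U_open i (nabla_g_smooth j X1_smooth) (_ : {in U, _ =1
     (fun q => connection_form j q *: X2 q)}) Up).
    by rewrite (nablaZ g i (connection_form_smooth j) X2_smooth Up) nabla_frame2 // rowDE !rowZE.
  by move=> q; rewrite inE => Uq; exact: nabla_frame1.
rewrite /curl rowBE.
refine (etrans (f_equal2 (fun x y : R => x - y) (E ord0 ord_max) (E ord_max ord0)) _).
generalize_atoms; move: (connection_form ord0 p) (connection_form ord_max p) => *; ring.
Qed.

Lemma riemann_frame2 l p : U p ->
  X2 p 0 ord0 * riemann g ord0 ord_max ord0 l p
  + X2 p 0 ord_max * riemann g ord0 ord_max ord_max l p
  = - curl connection_form p * X1 p 0 l.
Proof.
move=> Up.
rewrite -(nabla_curvature U_open g_smooth invg_smooth_frame ord0 ord_max l X2_smooth Up).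
have sN j := smoothN U_open (connection_form_smooth j).
have E i j : nabla g i (nabla g j X2) p 0 l =
  - partial i (connection_form j) p * X1 p 0 l
  + - connection_form j p * (connection_form i p * X2 p 0 l).
  rewrite (nabla_eq_on g U_open i (nabla_g_smooth j X2_smooth) (_ : {in U, _ =1
     (fun q => - connection_form j q *: X1 q)}) Up).
    rewrite (nablaZ g i (sN j) X1_smooth Up) nabla_frame1 //.
    by rewrite (partialN U_open Up i (connection_form_smooth j)) rowDE !rowZE.
  by move=> q; rewrite inE => Uq; exact: nabla_frame2.
rewrite /curl rowBE.
refine (etrans (f_equal2 (fun x y : R => x - y) (E ord0 ord_max) (E ord_max ord0)) _).
generalize_atoms; move: (connection_form ord0 p) (connection_form ord_max p) => *; ring.
Qed.

(** The factor that turns the value of a 2-form on the coordinate fields into its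
    value on the frame. *)
Definition frame_det p : R := X1 p 0 ord0 * X2 p 0 ord_max - X1 p 0 ord_max * X2 p 0 ord0.

Lemma frame_det_sqr p : U p -> \det (g p) * frame_det p ^+ 2 = 1.
Proof.
move=> Up; have /(congr1 determinant) := mul_frame_inverse Up.
rewrite det_mulmx det1 => <-; congr (_ * _).
rewrite /frame_det det_mx22.
rewrite !frame_inverseE; ring_atoms.
Qed.

(** The structure equation K = - d omega(X1, X2). Solving the two curvature equations
    of the frame for the [riemann] symbols gives a multiple of [frame_inverse], which
    the contraction with [g] in the definition of the curvature undoes. *)
Lemma gauss_curvature_frame p : U p ->
  gauss_curvature g p = - (frame_det p * curl connection_form p).
Proof.
move=> Up; rewrite /gauss_curvature sum_ord2.
have D2 := frame_det_sqr Up.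
have D_neq0 : frame_det p != 0.
  by apply/eqP => D0; move: D2; rewrite D0 expr0n mulr0 => /esym/eqP; rewrite oner_eq0.
have detg : \det (g p) = (frame_det p ^+ 2)^-1.
  by apply: (mulIf (expf_neq0 2 D_neq0)); rewrite D2 mulVf // expf_neq0.
have Dr l : frame_det p * riemann g ord0 ord_max ord_max l p
    = - curl connection_form p * frame_inverse p ord0 l.
  have := f_equal2 (fun a b => X1 p 0 ord0 * b - X2 p 0 ord0 * a)
            (riemann_frame1 l Up) (riemann_frame2 l Up).
  rewrite frame_inverseE /frame_det; set W := curl _ _; rewrite /=.
  by generalize_atoms => E; apply: etrans (etrans _ E) _; ring.
have inv00 := mul_frame_inverseE ord0 ord0 Up.
have inv_sym : frame_inverse p ord0 ord_max = frame_inverse p ord_max ord0.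
  by rewrite !frame_inverseE mulrC (mulrC (X2 p 0 ord0)).
rewrite detg invrK.
move: (Dr ord0) (Dr ord_max) inv00 inv_sym (g_sym p ord_max ord0).
move: (frame_det p) (curl _ p) => D W.
set r0 := riemann _ _ _ _ _ _; set r1 := riemann _ _ _ _ _ _.
generalize_atoms => E0 E1 inv00 inv_sym gs.
match goal with |- (r0 * ?a + r1 * ?b) * _ = _ =>
  transitivity (D * (D * r0 * a + D * r1 * b)); first by ring end.
rewrite E0 E1 gs inv_sym.
match type of inv00 with ?e = _ => transitivity (- (D * W) * e); first by ring end.
by rewrite inv00 mulr1.
Qed.

(** The derivative of [f] in the direction of the vector [x]. *)
Definition along (x : 'rV[R]_2) f p : R :=
  x 0 ord0 * partial ord0 f p + x 0 ord_max * partial ord_max f p.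

(** The trace of the covariant derivative of a 1-form; the divergence of the
    differential of [f] is convertible to [laplacian g f]. *)
Definition divergence h p : R :=
  \sum_(i < 2) \sum_(j < 2) invmx (g p) i j *
    (partial i (h j) p - \sum_(k < 2) christoffel g k i j p * h k p).

Lemma divergenceE h p : divergence h p =
  invmx (g p) ord0 ord0 * nabla_form g ord0 h ord0 p
  + invmx (g p) ord0 ord_max * nabla_form g ord0 h ord_max p
  + (invmx (g p) ord_max ord0 * nabla_form g ord_max h ord0 p
     + invmx (g p) ord_max ord_max * nabla_form g ord_max h ord_max p).
Proof.
transitivity (\sum_(i < 2) \sum_(j < 2) invmx (g p) i j * nabla_form g i h j p).
  apply: eq_bigr => i _; apply: eq_bigr => j _.
  by rewrite sum_ord2.
exact: (etrans (sum_ord2 _) (f_equal2 +%R (sum_ord2 _) (sum_ord2 _))).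
Qed.

Lemma along_pairing h (x : 'rV[R]_2) (Y : 'rV[R]_2 -> 'rV[R]_2) p :
    (forall j, smooth_on U (h j)) -> smooth_field U Y -> U p ->
  along x (fun q => pairing h (Y q) q) p =
  x 0 ord0 * pairing (nabla_form g ord0 h) (Y p) p
  + x 0 ord_max * pairing (nabla_form g ord_max h) (Y p) p
  + (x 0 ord0 * pairing h (nabla g ord0 Y p) p
     + x 0 ord_max * pairing h (nabla g ord_max Y p) p).
Proof.
move=> sh sY Up; have E i := partial_pairing g U_open i sh sY Up.
rewrite /along; refine (etrans (f_equal2 (fun a b => x 0 ord0 * a + x 0 ord_max * b)
  (E ord0) (E ord_max)) _).
by rewrite /= !mulrDr addrACA.
Qed.

Lemma pairingZ h (a : R) x p : pairing h (a *: x) p = a * pairing h x p.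
Proof. rewrite /pairing !rowZE; ring_atoms. Qed.

Lemma along_pairing_1 h (x : 'rV[R]_2) p : (forall j, smooth_on U (h j)) -> U p ->
  along x (fun q => pairing h (X1 q) q) p =
  x 0 ord0 * pairing (nabla_form g ord0 h) (X1 p) p
  + x 0 ord_max * pairing (nabla_form g ord_max h) (X1 p) p
  + pairing connection_form x p * pairing h (X2 p) p.
Proof.
move=> sh Up; rewrite (along_pairing x sh X1_smooth Up); congr (_ + _).
have E i : pairing h (nabla g i X1 p) p = connection_form i p * pairing h (X2 p) p.
  by rewrite nabla_frame1 // pairingZ.
refine (etrans (f_equal2 (fun a b => x 0 ord0 * a + x 0 ord_max * b)
  (E ord0) (E ord_max)) _).
rewrite /=; set y := pairing h _ _; rewrite /pairing.
move: y (connection_form ord0 p) (connection_form ord_max p) => *; ring_atoms.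
Qed.

Lemma along_pairing_2 h (x : 'rV[R]_2) p : (forall j, smooth_on U (h j)) -> U p ->
  along x (fun q => pairing h (X2 q) q) p =
  x 0 ord0 * pairing (nabla_form g ord0 h) (X2 p) p
  + x 0 ord_max * pairing (nabla_form g ord_max h) (X2 p) p
  - pairing connection_form x p * pairing h (X1 p) p.
Proof.
move=> sh Up; rewrite (along_pairing x sh X2_smooth Up); congr (_ + _).
have E i : pairing h (nabla g i X2 p) p = - connection_form i p * pairing h (X1 p) p.
  by rewrite nabla_frame2 // pairingZ.
refine (etrans (f_equal2 (fun a b => x 0 ord0 * a + x 0 ord_max * b)
  (E ord0) (E ord_max)) _).
rewrite /=; set y := pairing h _ _; rewrite /pairing.
move: y (connection_form ord0 p) (connection_form ord_max p) => *; ring_atoms.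
Qed.

(** The formula dh(X1, X2) = X1(h(X2)) - X2(h(X1)) - h([X1, X2]): by torsion freeness,
    [X1, X2] = nabla_X1 X2 - nabla_X2 X1 = - omega(X1) X1 - omega(X2) X2. *)
Lemma curl_frame h p : (forall j, smooth_on U (h j)) -> U p ->
  frame_det p * curl h p =
  along (X1 p) (fun q => pairing h (X2 q) q) p
  - along (X2 p) (fun q => pairing h (X1 q) q) p
  + pairing connection_form (X1 p) p * pairing h (X1 p) p
  + pairing connection_form (X2 p) p * pairing h (X2 p) p.
Proof.
move=> sh Up.
have := f_equal2 (fun a b : R => a - b)
  (along_pairing_2 (X1 p) sh Up) (along_pairing_1 (X2 p) sh Up).
rewrite /=; set a := along _ _ _; set b := along _ _ _ => ->.
move: (pairing connection_form _ _) (pairing connection_form _ _)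
  (pairing h _ _) (pairing h _ _) => w1 w2 h1 h2.
rewrite /pairing /nabla_form /curl /frame_det.
have := christoffel_sym g_sym ord0 ord0 ord_max p.
have := christoffel_sym g_sym ord_max ord0 ord_max p.
move: (h ord0 p) (h ord_max p); generalize_atoms => x0 x1 -> ->; ring.
Qed.

(** The sum over a of X_a(h(X_a)) - h(nabla_(X_a) X_a), where nabla_X1 X1 = omega(X1) X2
    and nabla_X2 X2 = - omega(X2) X1. *)
Lemma divergence_frame h p : (forall j, smooth_on U (h j)) -> U p ->
  divergence h p =
  along (X1 p) (fun q => pairing h (X1 q) q) p
  + along (X2 p) (fun q => pairing h (X2 q) q) p
  - pairing connection_form (X1 p) p * pairing h (X2 p) p
  + pairing connection_form (X2 p) p * pairing h (X1 p) p.
Proof.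
move=> sh Up.
have := f_equal2 (fun a b : R => a + b)
  (along_pairing_1 (X1 p) sh Up) (along_pairing_2 (X2 p) sh Up).
rewrite /=; set a := along _ _ _; set b := along _ _ _ => ->.
move: (pairing connection_form _ _) (pairing connection_form _ _)
  (pairing h _ _) (pairing h _ _) => w1 w2 h1 h2.
rewrite divergenceE invmx_frame // !frame_inverseE /pairing.
move: (nabla_form g ord0 h ord0 p) (nabla_form g ord0 h ord_max p)
  (nabla_form g ord_max h ord0 p) (nabla_form g ord_max h ord_max p).
by move=> *; ring_atoms.
Qed.

Lemma laplacian_frame f p : smooth_on U f -> U p ->
  laplacian g f p =
  along (X1 p) (fun q => along (X1 q) f q) p
  + along (X2 p) (fun q => along (X2 q) f q) p
  - pairing connection_form (X1 p) p * along (X2 p) f p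
  + pairing connection_form (X2 p) p * along (X1 p) f p.
Proof.
move=> sf Up.
have alongE x q : along x f q = pairing (fun j => partial j f) x q.
  rewrite /along /pairing; ring_atoms.
have sdf j : smooth_on U (partial j f) by exact: smooth_partial.
rewrite !alongE; under [in RHS]eq_fun do rewrite alongE.
under [X in _ + along _ X _ - _ + _]eq_fun do rewrite alongE.
exact: divergence_frame.
Qed.

Lemma gradient_frame f p : U p ->
  gradient g f p = along (X1 p) f p *: X1 p + along (X2 p) f p *: X2 p.
Proof.
move=> Up; apply/rowP => k; rewrite mxE rowDE !rowZE invmx_frame // sum_ord2.
rewrite !frame_inverseE /along; ring_atoms.
Qed.

Lemma grad_norm2_frame f p : U p ->
  grad_norm2 g f p = along (X1 p) f p ^+ 2 + along (X2 p) f p ^+ 2.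
Proof.
move=> Up; rewrite /grad_norm2 gradient_frame //.
move: (along (X1 p) f p) (along (X2 p) f p) => a b.
transitivity (a ^+ 2 * gdot g p (X1 p) (X1 p) + 2 * a * b * gdot g p (X1 p) (X2 p)
              + b ^+ 2 * gdot g p (X2 p) (X2 p)).
  rewrite !gdotE !rowDE !rowZE (g_sym p ord_max ord0).
  ring_atoms.
by rewrite X11 // X22 // X12 // !mulr1 mulr0 addr0.
Qed.

End OrthonormalFrame.

(** * The real inner product of complex vectors *)
Section HermitianSpace.
Variables (R : realType) (n : nat).
Implicit Types (z w x : 'rV[complex R]_n.+1) (a : R).

Lemma rdotE z w : rdot z w =
  \sum_(k < n.+1) (complex.Re (z 0 k) * complex.Re (w 0 k)
                   + complex.Im (z 0 k) * complex.Im (w 0 k)).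
Proof.
rewrite /rdot /herm raddf_sum; apply: eq_bigr => k _.
by case: (z 0 k) => a b; case: (w 0 k) => c d /=; ring.
Qed.

Lemma rdotC z w : rdot z w = rdot w z.
Proof. by rewrite !rdotE; apply: eq_bigr => k _; ring. Qed.

Lemma rdotDl z w x : rdot (z + w) x = rdot z x + rdot w x.
Proof.
rewrite !rdotE -big_split; apply: eq_bigr => k _; rewrite mxE.
by case: (z 0 k) => a b; case: (w 0 k) => c d /=; ring.
Qed.

Lemma rdotZl a z w : rdot (a%:C%C *: z) w = a * rdot z w.
Proof.
rewrite !rdotE mulr_sumr; apply: eq_bigr => k _; rewrite mxE.
by case: (z 0 k) => b c /=; ring.
Qed.

Lemma rdotDr z w x : rdot x (z + w) = rdot x z + rdot x w.
Proof. by rewrite rdotC rdotDl !(rdotC x). Qed.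

Lemma rdotZr a z w : rdot w (a%:C%C *: z) = a * rdot w z.
Proof. by rewrite rdotC rdotZl (rdotC w). Qed.

Lemma rdotNl z w : rdot (- z) w = - rdot z w.
Proof.
rewrite !rdotE -sumrN; apply: eq_bigr => k _; rewrite mxE.
by case: (z 0 k) => b c /=; ring.
Qed.

Lemma rdot0l w : rdot 0 w = 0.
Proof. by rewrite rdotE big1 // => k _; rewrite mxE /=; ring. Qed.

Lemma rdot_sum_l (I : finType) (f : I -> 'rV[complex R]_n.+1) w :
  rdot (\sum_i f i) w = \sum_i rdot (f i) w.
Proof. by elim/big_rec2: _ => [|i y x _ <-]; rewrite ?rdot0l ?rdotDl. Qed.

Lemma rdot_i_skew z w : rdot ('i%C *: z) w = - rdot z ('i%C *: w).
Proof.
rewrite !rdotE -sumrN; apply: eq_bigr => k _; rewrite !mxE.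
by case: (z 0 k) => a b; case: (w 0 k) => c d /=; ring.
Qed.

Lemma rdot_i_self z : rdot ('i%C *: z) z = 0.
Proof.
apply/eqP; have := rdot_i_skew z z; rewrite (rdotC z) => /eqP.
by rewrite -addr_eq0 -mulr2n mulrn_eq0.
Qed.

Lemma rdot_ii z w : rdot ('i%C *: z) ('i%C *: w) = rdot z w.
Proof.
rewrite !rdotE; apply: eq_bigr => k _; rewrite !mxE.
by case: (z 0 k) => a b; case: (w 0 k) => c d /=; ring.
Qed.

End HermitianSpace.

(** * Calculus of vector-valued maps *)
Section VectorCalculus.
Variables (R : realType) (n : nat) (U : set 'rV[R]_2).
Hypothesis U_open : open U.
Implicit Types (F G : 'rV[R]_2 -> 'rV[complex R]_n.+1) (p x y : 'rV[R]_2).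
Implicit Types (i j : 'I_2) (f : 'rV[R]_2 -> R).

Lemma diff_along f p x : 'd f p x = along x f p.
Proof.
rewrite {1}(row_sum_delta x) sum_ord2.
by rewrite linearD !linearZ.
Qed.

Lemma Re_tangent_map F p x k :
  complex.Re (tangent_map F p x 0 k) = 'd (fun q => complex.Re (F q 0 k)) p x.
Proof. by rewrite mxE. Qed.

Lemma Im_tangent_map F p x k :
  complex.Im (tangent_map F p x 0 k) = 'd (fun q => complex.Im (F q 0 k)) p x.
Proof. by rewrite mxE. Qed.

Lemma complex_rowP (z w : 'rV[complex R]_n.+1) :
  (forall k, complex.Re (z 0 k) = complex.Re (w 0 k)) ->
  (forall k, complex.Im (z 0 k) = complex.Im (w 0 k)) -> z = w.
Proof.
move=> hR hI; apply/rowP => k; move: (hR k) (hI k).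
by case: (z 0 k) => a b; case: (w 0 k) => c d /= -> ->.
Qed.

Lemma Re_vpartial i F p k :
  complex.Re (vpartial i F p 0 k) = partial i (fun q => complex.Re (F q 0 k)) p.
Proof. exact: Re_tangent_map. Qed.

Lemma Im_vpartial i F p k :
  complex.Im (vpartial i F p 0 k) = partial i (fun q => complex.Im (F q 0 k)) p.
Proof. exact: Im_tangent_map. Qed.

Lemma real_combinationE (a b : R) (z w : 'rV[complex R]_n.+1) k :
  (complex.Re ((a%:C%C *: z + b%:C%C *: w) 0 k)
     = a * complex.Re (z 0 k) + b * complex.Re (w 0 k)) *
  (complex.Im ((a%:C%C *: z + b%:C%C *: w) 0 k)
     = a * complex.Im (z 0 k) + b * complex.Im (w 0 k)).
Proof.
by split; rewrite !mxE; case: (z 0 k) => c d; case: (w 0 k) => e f /=; ring.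
Qed.

Lemma tangent_mapE F p x : tangent_map F p x =
  (x 0 ord0)%:C%C *: vpartial ord0 F p + (x 0 ord_max)%:C%C *: vpartial ord_max F p.
Proof.
apply: complex_rowP => k.
- rewrite Re_tangent_map diff_along real_combinationE /along.
  by rewrite -!Re_vpartial.
- rewrite Im_tangent_map diff_along real_combinationE /along.
  by rewrite -!Im_vpartial.
Qed.

Lemma smooth_vpartial i F : smooth_map U F -> smooth_map U (vpartial i F).
Proof.
move=> sF k; split.
- have -> : (fun p => complex.Re (vpartial i F p 0 k)) = partial i (fun q => complex.Re (F q 0 k)).
    by apply/funext => p; exact: Re_tangent_map.
  by apply: smooth_partial; case: (sF k).
- have -> : (fun p => complex.Im (vpartial i F p 0 k)) = partial i (fun q => complex.Im (F q 0 k)).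
    by apply/funext => p; exact: Im_tangent_map.
  by apply: smooth_partial; case: (sF k).
Qed.

Lemma vpartialC i j F p : smooth_map U F -> U p ->
  vpartial i (vpartial j F) p = vpartial j (vpartial i F) p.
Proof.
move=> sF Up; apply: complex_rowP => k; have [sR sI] := sF k.
- have E a b : complex.Re (vpartial a (vpartial b F) p 0 k)
      = partial a (partial b (fun q => complex.Re (F q 0 k))) p.
    rewrite Re_tangent_map /partial; congr ('d _ p _).
    by apply/funext => q; exact: Re_tangent_map.
  exact: (etrans (E i j) (etrans (partial_partialC U_open Up i j sR) (esym (E j i)))).
- have E a b : complex.Im (vpartial a (vpartial b F) p 0 k)
      = partial a (partial b (fun q => complex.Im (F q 0 k))) p.
    rewrite Im_tangent_map /partial; congr ('d _ p _).
    by apply/funext => q; exact: Im_tangent_map.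
  exact: (etrans (E i j) (etrans (partial_partialC U_open Up i j sI) (esym (E j i)))).
Qed.

Lemma smooth_i F : smooth_map U F -> smooth_map U (fun q => 'i%C *: F q).
Proof.
move=> sF k; have [sR sI] := sF k; split.
  have -> : (fun q => complex.Re (('i%C *: F q) 0 k)) = (fun q => - complex.Im (F q 0 k)).
    by apply/funext => q; rewrite mxE; case: (F q 0 k) => a b /=; ring.
  exact: smoothN.
have -> // : (fun q => complex.Im (('i%C *: F q) 0 k)) = (fun q => complex.Re (F q 0 k)).
by apply/funext => q; rewrite mxE; case: (F q 0 k) => a b /=; ring.
Qed.

Lemma vpartial_i i F p : smooth_map U F -> U p ->
  vpartial i (fun q => 'i%C *: F q) p = 'i%C *: vpartial i F p.
Proof.
move=> sF Up; apply: complex_rowP => k; have [sR sI] := sF k.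
- transitivity (partial i (fun q => - complex.Im (F q 0 k)) p).
    rewrite Re_tangent_map /partial; congr ('d _ p _); apply/funext => q.
    by rewrite mxE; case: (F q 0 k) => a b /=; ring.
  rewrite (partialN U_open Up i sI) mxE -[partial i _ p]Im_tangent_map.
  by case: (vpartial i F p 0 k) => a b /=; ring.
- transitivity (partial i (fun q => complex.Re (F q 0 k)) p).
    rewrite Im_tangent_map /partial; congr ('d _ p _); apply/funext => q.
    by rewrite mxE; case: (F q 0 k) => a b /=; ring.
  rewrite mxE -[partial i _ p]Re_tangent_map.
  by case: (vpartial i F p 0 k) => a b /=; ring.
Qed.

Lemma rdot_smooth F G : smooth_map U F -> smooth_map U G ->
  smooth_on U (fun q => rdot (F q) (G q)).
Proof.
move=> sF sG; under eq_fun do rewrite rdotE.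
apply: smooth_sum => // k; have [fR fI] := sF k; have [gR gI] := sG k.
exact: (smoothD U_open (smoothM U_open fR gR) (smoothM U_open fI gI)).
Qed.

Lemma partial_rdot i F G p : smooth_map U F -> smooth_map U G -> U p ->
  partial i (fun q => rdot (F q) (G q)) p =
  rdot (vpartial i F p) (G p) + rdot (F p) (vpartial i G p).
Proof.
move=> sF sG Up; under eq_fun do rewrite rdotE.
have sR k := smoothM U_open (sF k).1 (sG k).1.
have sI k := smoothM U_open (sF k).2 (sG k).2.
rewrite (partial_sum U_open Up _ i (fun k => smoothD U_open (sR k) (sI k))).
rewrite !rdotE -big_split; apply: eq_bigr => k _.
rewrite (partialD Up i (sR k) (sI k)).
rewrite (partialM Up i (sF k).1 (sG k).1) (partialM Up i (sF k).2 (sG k).2).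
move: (Re_vpartial i F p k) (Im_vpartial i F p k) (Re_vpartial i G p k) (Im_vpartial i G p k).
by rewrite /=; generalize_atoms => -> -> -> ->; ring.
Qed.

End VectorCalculus.

(** * The contact form of a surface *)
Section SurfaceInContactSphere.
Variables (R : realType) (n : nat) (U : set 'rV[R]_2) (F : 'rV[R]_2 -> 'rV[complex R]_n.+1).
Hypothesis U_open : open U.
Hypothesis F_smooth : smooth_map U F.
Implicit Types (p q x y : 'rV[R]_2) (i j k l : 'I_2).

Let g := induced_metric F.

Lemma induced_metricE q i j : g q i j = rdot (vpartial i F q) (vpartial j F q).
Proof. by rewrite mxE. Qed.

Lemma induced_metric_sym q i j : g q i j = g q j i.
Proof. by rewrite !induced_metricE rdotC. Qed.

Lemma induced_metric_smooth i j : smooth_on U (fun q => g q i j).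
Proof.
have -> : (fun q => g q i j) = (fun q => rdot (vpartial i F q) (vpartial j F q)).
  by apply/funext => q; exact: induced_metricE.
by apply: rdot_smooth => //; exact: smooth_vpartial.
Qed.

Lemma gdot_induced_metric q x y :
  gdot g q x y = rdot (tangent_map F q x) (tangent_map F q y).
Proof.
rewrite gdotE !induced_metricE !tangent_mapE !rdotDl !rdotDr !rdotZl !rdotZr.
ring_atoms.
Qed.

(** The tangential part of [d_i d_j F] is the covariant derivative of [d_j F]. *)
Lemma first_kind_christoffel i j l p : U p ->
  2^-1 * (partial i (fun q => g q j l) p + partial j (fun q => g q i l) p
          - partial l (fun q => g q i j) p)
  = rdot (vpartial i (vpartial j F) p) (vpartial l F p).
Proof.
move=> Up; have sV a : smooth_map U (vpartial a F) by exact: smooth_vpartial.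
have E a b c : partial a (fun q => g q b c) p =
    rdot (vpartial a (vpartial b F) p) (vpartial c F p)
    + rdot (vpartial a (vpartial c F) p) (vpartial b F p).
  have -> : (fun q => g q b c) = (fun q => rdot (vpartial b F q) (vpartial c F q)).
    by apply/funext => q; exact: induced_metricE.
  by rewrite (partial_rdot U_open a (sV b) (sV c) Up) (rdotC (vpartial b F p)).
have C a b : vpartial a (vpartial b F) p = vpartial b (vpartial a F) p.
  exact: (vpartialC U_open a b F_smooth Up).
move: (E i j l) (E j i l) (E l i j); rewrite (C j i) (C l i) (C l j).
generalize_atoms => -> -> ->.
by field.
Qed.

(** The restriction to the surface of the contact form [<xi, .>]. *)
Definition contact_form i q : R := rdot (reeb (F q)) (vpartial i F q).

Lemma contact_form_smooth i : smooth_on U (contact_form i).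
Proof.
by apply: rdot_smooth => //; [exact: smooth_i|exact: smooth_vpartial].
Qed.

Lemma pairing_contact_form x q :
  pairing contact_form x q = rdot (reeb (F q)) (tangent_map F q x).
Proof.
rewrite tangent_mapE rdotDr !rdotZr /pairing /contact_form.
by rewrite mulrC (mulrC (x 0 ord_max)).
Qed.

Lemma partial_contact_form i j p : U p ->
  partial i (contact_form j) p =
  rdot ('i%C *: vpartial i F p) (vpartial j F p)
  + rdot (reeb (F p)) (vpartial i (vpartial j F) p).
Proof.
move=> Up.
rewrite (partial_rdot U_open i (smooth_i U_open F_smooth) (smooth_vpartial j F_smooth) Up).
by rewrite (vpartial_i U_open i F_smooth Up).
Qed.

(** In [d_i h_j = <i d_i F, d_j F> + <iF, d_i d_j F>] the second term is symmetric. *)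
Lemma curl_contact_form p : U p ->
  curl contact_form p = 2 * rdot ('i%C *: vpartial ord0 F p) (vpartial ord_max F p).
Proof.
move=> Up; rewrite /curl.
refine (etrans (f_equal2 (fun a b : R => a - b) (partial_contact_form ord0 ord_max Up)
  (partial_contact_form ord_max ord0 Up)) _).
rewrite /= (vpartialC U_open ord_max ord0 F_smooth Up).
rewrite (rdot_i_skew (vpartial ord_max F p)) (rdotC (vpartial ord_max F p)).
by move: (rdot _ _) (rdot _ _) => *; ring.
Qed.

Lemma curl_contact_form_frame (X1 X2 : 'rV[R]_2 -> 'rV[R]_2) p : U p ->
  frame_det X1 X2 p * curl contact_form p =
  2 * rdot ('i%C *: tangent_map F p (X1 p)) (tangent_map F p (X2 p)).
Proof.
move=> Up; rewrite (curl_contact_form Up) !tangent_mapE scalerDr.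
rewrite !scalerA -!(mulrC _ 'i%C) -!scalerA.
rewrite rdotDl !rdotDr !rdotZl !rdotZr !rdot_i_self.
have -> : rdot ('i%C *: vpartial ord_max F p) (vpartial ord0 F p)
    = - rdot ('i%C *: vpartial ord0 F p) (vpartial ord_max F p).
  by rewrite rdot_i_skew (rdotC (vpartial ord_max F p)).
rewrite /frame_det; ring_atoms.
Qed.

Lemma induced_christoffel k i j p : U p ->
  christoffel g k i j p =
  \sum_(l < 2) invmx (g p) k l * rdot (vpartial i (vpartial j F) p) (vpartial l F p).
Proof.
move=> Up; rewrite /christoffel mulr_sumr; apply: eq_bigr => l _.
by rewrite mulrCA (first_kind_christoffel i j l Up).
Qed.

Lemma rdot_normal_part p w : rdot (normal_part F p w) (reeb (F p)) =
  rdot w (reeb (F p))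
  - \sum_(k < 2) (\sum_(l < 2) invmx (g p) k l * rdot w (vpartial l F p)) * contact_form k p.
Proof.
rewrite /normal_part !rdotDl !rdotNl rdotZl (rdotC (F p)) /reeb rdot_i_self mulr0 subr0.
congr (_ - _); rewrite rdot_sum_l; apply: eq_bigr => k _.
rewrite rdot_sum_l mulr_suml; apply: eq_bigr => l _.
by rewrite rdotZl (rdotC (vpartial k F p)).
Qed.

(** The Christoffel terms remove from [d_i d_j F] exactly its tangential part, and the
    component along [F] is orthogonal to the Reeb vector, so the normal part remains. *)
Lemma nabla_contact_form i j p : U p ->
  nabla_form g i contact_form j p =
  rdot ('i%C *: vpartial i F p) (vpartial j F p)
  + rdot (second_form F i j p) (reeb (F p)).
Proof.
move=> Up; rewrite /nabla_form /second_form rdot_normal_part sum_ord2.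
rewrite -!(induced_christoffel _ i j Up) (partial_contact_form i j Up).
by rewrite (rdotC (reeb (F p))) addrA.
Qed.

(** The skew part of the covariant derivative of [h] has no trace, and the trace of the
    rest is the mean curvature vector paired with the Reeb vector. *)
Lemma divergence_contact_form p : U p -> mean_curvature F p = 0 ->
  divergence g contact_form p = 0.
Proof.
move=> Up H0; rewrite divergenceE.
have inv_sym : invmx (g p) ord_max ord0 = invmx (g p) ord0 ord_max.
  have gT : (g p)^T = g p by apply/matrixP => i j; rewrite mxE induced_metric_sym.
  by rewrite -[in RHS]gT -trmx_inv mxE.
have trace0 : \sum_(i < 2) \sum_(j < 2)
    invmx (g p) i j * rdot (second_form F i j p) (reeb (F p)) = 0.
  have := congr1 (fun w => rdot w (reeb (F p))) H0.
  rewrite /= rdot0l /mean_curvature rdotZl => /eqP.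
  rewrite mulf_eq0 invr_eq0 pnatr_eq0 /= => /eqP E0.
  refine (etrans _ E0); rewrite rdot_sum_l; apply: eq_bigr => i _.
  by rewrite rdot_sum_l; apply: eq_bigr => j _; rewrite rdotZl.
move: (etrans (esym (etrans (sum_ord2 _) (f_equal2 +%R (sum_ord2 _) (sum_ord2 _)))) trace0).
move: (nabla_contact_form ord0 ord0 Up) (nabla_contact_form ord0 ord_max Up)
  (nabla_contact_form ord_max ord0 Up) (nabla_contact_form ord_max ord_max Up).
have skew : rdot ('i%C *: vpartial ord_max F p) (vpartial ord0 F p)
    = - rdot ('i%C *: vpartial ord0 F p) (vpartial ord_max F p).
  by rewrite rdot_i_skew (rdotC (vpartial ord_max F p)).
move: inv_sym skew (rdot_i_self (vpartial ord0 F p)) (rdot_i_self (vpartial ord_max F p)).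
move: (nabla_form _ _ _ _ _) (nabla_form _ _ _ _ _) (nabla_form _ _ _ _ _) (nabla_form _ _ _ _ _).
generalize_atoms => ? ? ? ? -> -> -> -> -> -> -> -> T.
by rewrite -[RHS]T; ring.
Qed.

End SurfaceInContactSphere.

(** * The curvature in terms of the two angles *)
Section AlongCalculus.
Variables (R : realType) (U : set 'rV[R]_2).
Hypothesis U_open : open U.
Variables (x p : 'rV[R]_2).
Hypothesis Up : U p.
Implicit Types (f h : 'rV[R]_2 -> R).

Lemma along_eq f h : smooth_on U f -> {in U, f =1 h} -> along x f p = along x h p.
Proof.
move=> sf fh; rewrite /along.
by rewrite (partial_eq U_open Up ord0 sf fh) (partial_eq U_open Up ord_max sf fh).
Qed.

Lemma along_cst (c : R) : along x (fun=> c) p = 0.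
Proof. by rewrite /along !partial_cst !mulr0 addr0. Qed.

Lemma alongM f h : smooth_on U f -> smooth_on U h ->
  along x (fun q => f q * h q) p = f p * along x h p + h p * along x f p.
Proof.
move=> sf sh; rewrite /along (partialM Up ord0 sf sh) (partialM Up ord_max sf sh).
move: (f p) (h p) => *; ring_atoms.
Qed.

Lemma alongD f h : smooth_on U f -> smooth_on U h ->
  along x (fun q => f q + h q) p = along x f p + along x h p.
Proof.
move=> sf sh; rewrite /along (partialD Up ord0 sf sh) (partialD Up ord_max sf sh).
ring_atoms.
Qed.

Lemma along_cos f : smooth_on U f ->
  along x (fun q => cos (f q)) p = - sin (f p) * along x f p.
Proof.
move=> sf; rewrite /along (partial_cos Up ord0 sf) (partial_cos Up ord_max sf).
move: (sin _) => *; ring_atoms.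
Qed.

Lemma along_sin f : smooth_on U f ->
  along x (fun q => sin (f q)) p = cos (f p) * along x f p.
Proof.
move=> sf; rewrite /along (partial_sin Up ord0 sf) (partial_sin Up ord_max sf).
move: (cos _) => *; ring_atoms.
Qed.

End AlongCalculus.

Lemma along_smooth (R : realType) (U : set 'rV[R]_2) (X : 'rV[R]_2 -> 'rV[R]_2) f :
  open U -> smooth_field U X -> smooth_on U f -> smooth_on U (fun q => along (X q) f q).
Proof.
move=> U_open sX sf; have s i := smoothM U_open (sX i) (smooth_partial i sf).
exact: (smoothD U_open (s ord0) (s ord_max)).
Qed.

Section AdaptedFrame.
Variables (R : realType) (n : nat) (U : set 'rV[R]_2) (F : 'rV[R]_2 -> 'rV[complex R]_n.+1).
Variables (X1 X2 : 'rV[R]_2 -> 'rV[R]_2) (beta alpha : 'rV[R]_2 -> R).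
Variable v : 'rV[R]_2 -> 'rV[complex R]_n.+1.
Hypothesis U_open : open U.
Hypothesis F_minimal : minimal_surface U F.
Hypothesis frameP : adapted_frame U F X1 X2.
Hypothesis betaP : contact_angle U F X2 beta.
Hypothesis vP : contact_direction U F X2 beta v.
Hypothesis alphaP : kahler_angle U F X1 v alpha.
Implicit Types (p q : 'rV[R]_2).

Let g := induced_metric F.
Let h := contact_form F.

Let F_smooth : smooth_map U F.
Proof. by case: F_minimal => -[]. Qed.

Let X1_smooth : smooth_field U X1.
Proof. by case: frameP. Qed.

Let X2_smooth : smooth_field U X2.
Proof. by case: frameP. Qed.

Let g_sym := induced_metric_sym F : forall q i j, g q i j = g q j i.
Let g_smooth := induced_metric_smooth U_open F_smooth : forall i j, smooth_on U (fun q => g q i j).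
Let h_smooth := contact_form_smooth U_open F_smooth : forall i, smooth_on U (h i).

Lemma adapted_frame_orthonormal q : U q ->
  [/\ gdot g q (X1 q) (X1 q) = 1, gdot g q (X2 q) (X2 q) = 1
    & gdot g q (X1 q) (X2 q) = 0].
Proof.
move=> Uq; have [_ _ /(_ q Uq) [e11 e22 e12 _]] := frameP.
by split; rewrite gdot_induced_metric.
Qed.

Let X11 q (Uq : U q) := let: And3 e _ _ := adapted_frame_orthonormal Uq in e.
Let X22 q (Uq : U q) := let: And3 _ e _ := adapted_frame_orthonormal Uq in e.
Let X12 q (Uq : U q) := let: And3 _ _ e := adapted_frame_orthonormal Uq in e.

Lemma contact_form_X1 q : U q -> pairing h (X1 q) q = 0.
Proof.
move=> Uq; rewrite pairing_contact_form.
by have [_ _ /(_ q Uq) [_ _ _ [_ ->]]] := frameP.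
Qed.

Lemma contact_form_X2 q : U q -> pairing h (X2 q) q = cos (beta q).
Proof. by move=> Uq; rewrite pairing_contact_form; have [_ ->] := betaP. Qed.

(** In [e2 = sin(beta) v + cos(beta) xi] the vector [xi = i F] contributes
    [<i e1, i F> = <e1, F> = 0]. *)
Lemma rdot_i_frame q : U q ->
  rdot ('i%C *: tangent_map F q (X1 q)) (tangent_map F q (X2 q))
  = sin (beta q) * cos (alpha q).
Proof.
move=> Uq; have [_ /(_ q Uq) [_ _ ->]] := vP.
rewrite rdotDr !rdotZr /reeb rdot_ii; have [_ <- //] := alphaP.
have [_ _ /(_ q Uq) [_ _ _ [e1F _]]] := frameP.
by rewrite (rdotC _ (F q)) [rdot (F q) _]e1F mulr0 addr0.
Qed.

Let w i := connection_form g X1 X2 i.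
Let b1 q := along (X1 q) beta q.
Let b2 q := along (X2 q) beta q.
Let w1 q := pairing w (X1 q) q.
Let w2 q := pairing w (X2 q) q.

Let beta_smooth : smooth_on U beta.
Proof. by case: betaP. Qed.

Let alpha_smooth : smooth_on U alpha.
Proof. by case: alphaP. Qed.

Let w_smooth i : smooth_on U (w i).
Proof.
exact: (connection_form_smooth U_open g_sym g_smooth X1_smooth X2_smooth X11 X22 X12).
Qed.

Let w1_smooth : smooth_on U w1.
Proof. exact: (pairing_smooth U_open w_smooth X1_smooth). Qed.

Let w2_smooth : smooth_on U w2.
Proof. exact: (pairing_smooth U_open w_smooth X2_smooth). Qed.

Let b1_smooth : smooth_on U b1.
Proof. exact: along_smooth. Qed.

Let b2_smooth : smooth_on U b2.
Proof. exact: along_smooth. Qed.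

Lemma along_contact_form_X1 x p : U p -> along x (fun q => pairing h (X1 q) q) p = 0.
Proof.
move=> Up; rewrite (along_eq U_open x Up (h := fun=> 0)) ?along_cst //.
  exact: (pairing_smooth U_open h_smooth X1_smooth).
by move=> q; rewrite inE => Uq; exact: contact_form_X1.
Qed.

Lemma along_contact_form_X2 x p : U p ->
  along x (fun q => pairing h (X2 q) q) p = - sin (beta p) * along x beta p.
Proof.
move=> Up; rewrite -(along_cos x Up beta_smooth).
apply: (along_eq U_open x Up).
  exact: (pairing_smooth U_open h_smooth X2_smooth).
by move=> q; rewrite inE => Uq; exact: contact_form_X2.
Qed.

(** Vanishing of [div h], written in the frame. *)
Lemma connection_form_X1 p : U p ->
  cos (beta p) * w1 p = - (sin (beta p) * b2 p).
Proof.
move=> Up; have [_ /(_ p Up) H0] := F_minimal.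
have := divergence_contact_form U_open F_smooth Up H0.
rewrite (divergence_frame U_open g_sym g_smooth X1_smooth X2_smooth X11 X22 X12 h_smooth Up).
rewrite along_contact_form_X1 // along_contact_form_X2 // contact_form_X1 //.
rewrite contact_form_X2 // -/(w1 p) -/(w2 p) -/(b2 p).
move: (cos _) (sin _) (w1 p) (w2 p) (b2 p) => c s u1 u2 e E.
by apply/eqP; rewrite -subr_eq0 -oppr_eq0 -E; apply/eqP; ring.
Qed.

(** The value of [dh] on the frame, computed in two ways. *)
Lemma connection_form_X2 p : U p ->
  cos (beta p) * w2 p = sin (beta p) * b1 p + 2 * (sin (beta p) * cos (alpha p)).
Proof.
move=> Up.
have := curl_contact_form_frame U_open F_smooth X1 X2 Up; rewrite rdot_i_frame // => <-.
rewrite (curl_frame U_open g_sym g_smooth X1_smooth X2_smooth X11 X22 X12 h_smooth Up).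
rewrite along_contact_form_X1 // along_contact_form_X2 // contact_form_X1 //.
rewrite contact_form_X2 // -/(w1 p) -/(w2 p) -/(b1 p).
by move: (cos _) (sin _) (w1 p) (w2 p) (b1 p) => *; ring.
Qed.

(** [connection_form_X1] holds on all of [U], hence may be differentiated; the tangent
    of [beta] is avoided because [cos beta] may vanish elsewhere on [U]. *)
Lemma along_connection_form_X1 x p : U p ->
  cos (beta p) * along x w1 p =
  sin (beta p) * along x beta p * w1 p
  - cos (beta p) * along x beta p * b2 p - sin (beta p) * along x b2 p.
Proof.
move=> Up.
have sc := smooth_cos U_open beta_smooth; have ss := smooth_sin U_open beta_smooth.
have sL := smoothM U_open sc w1_smooth; have sR := smoothM U_open ss b2_smooth.
have : along x (fun q => cos (beta q) * w1 q + sin (beta q) * b2 q) p = 0.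
  rewrite (along_eq U_open x Up (smoothD U_open sL sR) (h := fun=> 0)) ?along_cst // => q.
  by rewrite inE => Uq; rewrite connection_form_X1 // addNr.
rewrite (alongD x Up sL sR) (alongM x Up sc w1_smooth) (alongM x Up ss b2_smooth).
rewrite (along_cos x Up beta_smooth) (along_sin x Up beta_smooth).
move: (cos _) (sin _) (w1 p) (along x w1 p) (b2 p) (along x b2 p) (along x beta p).
move=> c s u du b db a E; apply/eqP; rewrite -subr_eq0 -[X in _ == X]E; apply/eqP; ring.
Qed.

Lemma along_connection_form_X2 x p : U p ->
  cos (beta p) * along x w2 p =
  sin (beta p) * along x beta p * w2 p
  + cos (beta p) * along x beta p * b1 p + sin (beta p) * along x b1 p
  + 2 * (cos (beta p) * along x beta p * cos (alpha p)
         - sin (beta p) * sin (alpha p) * along x alpha p).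
Proof.
move=> Up.
have sc := smooth_cos U_open beta_smooth; have ss := smooth_sin U_open beta_smooth.
have sa := smooth_cos U_open alpha_smooth.
have sL := smoothM U_open sc w2_smooth; have sR := smoothM U_open ss b1_smooth.
have sK := smoothM U_open ss sa; have s2K := smoothM U_open (smooth_cst U_open 2) sK.
have : along x (fun q => cos (beta q) * w2 q) p
     = along x (fun q => sin (beta q) * b1 q + 2 * (sin (beta q) * cos (alpha q))) p.
  by apply: (along_eq U_open x Up sL) => q; rewrite inE; exact: connection_form_X2.
rewrite (alongD x Up sR s2K) (alongM x Up sc w2_smooth) (alongM x Up ss b1_smooth).
rewrite (alongM x Up (smooth_cst U_open 2) sK) (alongM x Up ss sa) along_cst.
rewrite (along_cos x Up beta_smooth) (along_cos x Up alpha_smooth).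
rewrite (along_sin x Up beta_smooth).
move: (cos (beta p)) (sin (beta p)) (cos (alpha p)) (sin (alpha p)) (w2 p) (along x w2 p)
  (b1 p) (along x b1 p) (along x beta p) (along x alpha p).
move=> c s ca sa' u du b db a al E; apply/eqP; rewrite -subr_eq0.
move/eqP: E; rewrite -subr_eq0 => /eqP E; rewrite -[X in _ == X]E; apply/eqP; ring.
Qed.

(** At a point with [cos beta] nonzero the four identities above are solved for
    [w1], [w2], [X2(w1)] and [X1(w2)]; what remains is an identity of polynomials in
    [tan beta], after [sec^2 = 1 + tan^2]. *)
Lemma gauss_curvature_angles p : U p -> cos (beta p) != 0 ->
  gauss_curvature g p =
    - (cos (beta p)) ^- 2 * grad_norm2 g beta p
    - tan (beta p) * laplacian g beta p
    - 2 * cos (alpha p) * (1 + 2 * tan (beta p) ^+ 2) * 'd beta p (X1 p)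
    + 2 * tan (beta p) * sin (alpha p) * 'd alpha p (X1 p)
    - 4 * tan (beta p) ^+ 2 * cos (alpha p) ^+ 2.
Proof.
move=> Up cos_neq0.
rewrite (gauss_curvature_frame U_open g_sym g_smooth X1_smooth X2_smooth X11 X22 X12 Up).
rewrite (curl_frame U_open g_sym g_smooth X1_smooth X2_smooth X11 X22 X12 w_smooth Up).
rewrite (grad_norm2_frame g_sym X11 X22 X12 beta Up).
rewrite (laplacian_frame U_open g_sym g_smooth X1_smooth X2_smooth X11 X22 X12 beta_smooth Up).
rewrite !diff_along -/(w1 p) -/(w2 p) -/(b1 p) -/(b2 p).
have w1E : w1 p = - tan (beta p) * b2 p.
  apply: (mulfI cos_neq0); rewrite connection_form_X1 // /tan.
  by move: (cos _) (sin _) cos_neq0 (b2 p) => c s c0 b; field.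
have w2E : w2 p = tan (beta p) * (b1 p + 2 * cos (alpha p)).
  apply: (mulfI cos_neq0); rewrite connection_form_X2 // /tan.
  by move: (cos (beta p)) (sin (beta p)) cos_neq0 (cos (alpha p)) (b1 p) => c s c0 a b; field.
have dw1E : along (X2 p) w1 p = tan (beta p) * b2 p * w1 p - b2 p ^+ 2
    - tan (beta p) * along (X2 p) b2 p.
  apply: (mulfI cos_neq0); rewrite along_connection_form_X1 // -/(b2 p) /tan.
  move: (cos _) (sin _) cos_neq0 (b2 p) (w1 p) (along _ b2 p) => c s c0 b u db.
  by field.
have dw2E : along (X1 p) w2 p = tan (beta p) * b1 p * w2 p + b1 p ^+ 2
    + tan (beta p) * along (X1 p) b1 p
    + 2 * (b1 p * cos (alpha p) - tan (beta p) * sin (alpha p) * along (X1 p) alpha p).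
  apply: (mulfI cos_neq0); rewrite along_connection_form_X2 // -/(b1 p) /tan.
  move: (cos (beta p)) (sin (beta p)) cos_neq0 (cos (alpha p)) (sin (alpha p)) (b1 p) (w2 p)
    (along (X1 p) b1 p) (along (X1 p) alpha p) => c s c0 ca sa b u db da.
  by field.
have sec2 : (cos (beta p)) ^- 2 = 1 + tan (beta p) ^+ 2.
  rewrite /tan expr_div_n -[X in X + _](divff (expf_neq0 2 cos_neq0)) -mulrDl.
  by rewrite cos2Dsin2 mul1r.
rewrite sec2 -[fun q => pairing _ (X1 q) q]/w1 -[fun q => pairing _ (X2 q) q]/w2.
rewrite dw1E dw2E w1E w2E.
move: (tan (beta p)) (cos (alpha p)) (sin (alpha p)) (b1 p) (b2 p)
  (along (X1 p) b1 p) (along (X2 p) b2 p) (along (X1 p) alpha p).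
move=> t c s y1 y2 d1 d2 a.
ring.
Qed.

End AdaptedFrame.

Theorem mainTheorem1 (R : realType) (n : nat) (U : set 'rV[R]_2)
    (F : 'rV[R]_2 -> 'rV[complex R]_n.+1)
    (X1 X2 : 'rV[R]_2 -> 'rV[R]_2)
    (beta alpha : 'rV[R]_2 -> R) (v : 'rV[R]_2 -> 'rV[complex R]_n.+1)
    (hU : open U) (hF : minimal_surface U F)
    (hX : adapted_frame U F X1 X2)
    (hbeta : contact_angle U F X2 beta)
    (hv : contact_direction U F X2 beta v)
    (halpha : kahler_angle U F X1 v alpha)
    (p : 'rV[R]_2) (hp : U p) (hcos : cos (beta p) != 0) :
  let g := induced_metric F in
  let beta1 := 'd beta p (X1 p) in
  let alpha1 := 'd alpha p (X1 p) in
  gauss_curvature g p =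
    - (cos (beta p)) ^- 2 * grad_norm2 g beta p
    - tan (beta p) * laplacian g beta p
    - 2 * cos (alpha p) * (1 + 2 * tan (beta p) ^+ 2) * beta1
    + 2 * tan (beta p) * sin (alpha p) * alpha1
    - 4 * tan (beta p) ^+ 2 * cos (alpha p) ^+ 2.
Proof. exact: (gauss_curvature_angles hU hF hX hbeta hv halpha hp hcos). Qed.
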